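(* Let $\widetilde{M}$ be an $(LCS)_n$-manifold with structure $(\phi,\xi,\eta,g,\alpha)$, and let $M$ be an invariant submanifold of $\widetilde{M}$ of dimension $m<n$, with induced metric $g$. If $(g,\xi,\lambda)$ is a Ricci soliton on $M$, then $M$ is $\eta$-Einstein and $M$ is minimal in $\widetilde{M}$.
   Context: An $(LCS)_n$-manifold (Lorentzian concircular structure manifold) is an $n$-dimensional Lorentzian manifold $(\widetilde{M},g)$ (smooth, connected, paracompact, Hausdorff; signature $(-,+,\dots,+)$) with Levi-Civita connection $\widetilde{\nabla}$, together with a unit timelike vector field $\xi$ ($g(\xi,\xi)=-1$), the 1-form $\eta(X)=g(X,\xi)$, a nowhere-zero smooth function $\alpha$ such that $\widetilde{\nabla}_X\xi=\alpha\{X+\eta(X)\xi\}$ for all $X$ (equivalently $(\widetilde{\nabla}_X\eta)(Y)=\alpha\{g(X,Y)+\eta(X)\eta(Y)\}$) and $d\alpha=\rho\,\eta$ with $\rho=-(\xi\alpha)$, and the $(1,1)$-tensor $\phi X=\frac1\alpha\widetilde{\nabla}_X\xi=X+\eta(X)\xi$. A submanifold $M$ of $\widetilde{M}$ is invariant if $\xi$ is tangent to $M$ at every point of $M$ and $\phi X$ is tangent to $M$ for every $X$ tangent to $M$, i.e. $\phi(TM)\subset TM$. The induced metric on $M$ is also denoted $g$, and the restrictions of $\xi,\eta,\alpha$ to $M$ are denoted by the same symbols. $(g,\xi,\lambda)$, with $\lambda\in\mathbb{R}$, is a Ricci soliton on $M$ if $(\pounds_\xi g)(Y,Z)+2S(Y,Z)+2\lambda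 g(Y,Z)=0$ for all vector fields $Y,Z$ tangent to $M$, where $\pounds_\xi$ is the Lie derivative along $\xi$ and $S$ is the Ricci tensor of $(M,g)$. $M$ is $\eta$-Einstein if $S=p\,g+q\,\eta\otimes\eta$ on $M$ for some smooth functions $p,q$ on $M$. The second fundamental form $h$ of $M$ is defined by the Gauss formula $\widetilde{\nabla}_XY=\nabla_XY+h(X,Y)$ ($\nabla_XY$ tangent, $h(X,Y)$ normal to $M$), for $X,Y$ tangent to $M$. The mean curvature vector is $H=\frac1m\,\mathrm{trace}_g\,h$, and $M$ is minimal in $\widetilde{M}$ if $H=0$. *)

(* Defs.v *)
From mathcomp Require Import all_boot all_order all_algebra.
From mathcomp Require Import all_classical all_reals all_analysis.

Set Implicit Arguments.
Unset Strict Implicit.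
Unset Printing Implicit Defensive.

Import Order.TTheory GRing.Theory Num.Theory.
Import numFieldNormedType.Exports.
Local Open Scope classical_set_scope.
Local Open Scope ring_scope.

(* Tangent vectors are written in coordinates as row vectors, so a
   differential acts on the right: v |-> v *m 'J f u. *)

(* C^oo on an open set U: all iterated partial derivatives are (Frechet)
   differentiable on U. *)
Definition iter_partial (R : realType) (n : nat) (V : normedModType R)
    (s : seq 'I_n) (f : 'rV[R]_n -> V) : 'rV[R]_n -> V :=
  foldr (fun i h => fun u => 'D_('e_i) h u) f s.

Definition smooth_on (R : realType) (n : nat) (V : normedModType R)
    (U : set 'rV[R]_n) (f : 'rV[R]_n -> V) : Prop :=
  forall (s : seq 'I_n) (u : 'rV[R]_n), U u -> differentiable (iter_partial s f) u.

Definition paracompact (T : topologicalType) : Prop :=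
  forall U : set (set T),
    (forall A, U A -> open A) -> \bigcup_(A in U) A = setT ->
  exists V : set (set T),
    [/\ forall B, V B -> open B,
        \bigcup_(B in V) B = setT,
        forall B, V B -> exists2 A, U A & B `<=` A &
        forall p : T, exists2 W, nbhs p W &
          finite_set [set B | V B /\ B `&` W !=set0]].

(* A chart a is the homeomorphism coord a from the open set dom a onto an open
   subset of R^n, with inverse param a; the values of coord a outside dom a and
   of param a outside the image of the chart are irrelevant.  chart_at selects
   a chart around each point. *)
Record manifold (R : realType) (n : nat) := Manifold {
  carrier :> topologicalType;
  atlas : Type;
  dom : atlas -> set carrier;
  coord : atlas -> carrier -> 'rV[R]_n;
  param : atlas -> 'rV[R]_n -> carrier;
  chart_at : carrier -> atlas;
  chart_atP : forall p, dom (chart_at p) p;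
  dom_open : forall a, open (dom a);
  img_open : forall a, open (coord a @` dom a);
  coordK : forall a p, dom a p -> param a (coord a p) = p;
  coord_continuous : forall a p, dom a p -> {for p, continuous (coord a)};
  param_continuous : forall a u,
    (coord a @` dom a) u -> {for u, continuous (param a)};
  transition_smooth : forall a b,
    smooth_on [set u | (coord a @` dom a) u /\ dom b (param a u)]
              (coord b \o param a);
  manifold_hausdorff : hausdorff_space carrier;
  manifold_paracompact : paracompact carrier }.

Arguments atlas {R n} m.
Arguments dom {R n m} a.
Arguments coord {R n m} a p.
Arguments param {R n m} a u.
Arguments chart_at {R n} m p.

Definition img (R : realType) (n : nat) (M : manifold R n) (a : atlas M) :
    set 'rV[R]_n :=
  coord a @` dom a.

Definition locrep (R : realType) (m n : nat) (M : manifold R m)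
    (N : manifold R n) (f : M -> N) (a : atlas M) (b : atlas N) :
    'rV[R]_m -> 'rV[R]_n :=
  fun u => coord b (f (param a u)).

Definition smooth_fun (R : realType) (n : nat) (M : manifold R n)
    (f : M -> R) : Prop :=
  forall a : atlas M, smooth_on (img a) (f \o param a).

Definition smooth_map (R : realType) (m n : nat) (M : manifold R m)
    (N : manifold R n) (f : M -> N) : Prop :=
  continuous f /\
  forall (a : atlas M) (b : atlas N),
    smooth_on [set u | img a u /\ dom b (f (param a u))] (locrep f a b).

(* Tensor fields are given by their components in every chart, as functions on
   the image of the chart, subject to the transformation law on overlaps. *)
Record vector_field (R : realType) (n : nat) (M : manifold R n) := VectorField {
  vf_comp :> atlas M -> 'rV[R]_n -> 'rV[R]_n;
  vf_smooth : forall a, smooth_on (img a) (vf_comp a);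
  vf_compat : forall a b u, img a u -> dom b (param a u) ->
    vf_comp b (locrep id a b u) = vf_comp a u *m 'J (locrep id a b) u }.

(* Some basis (the rows of P) has Gram matrix diag(-1, 1, ..., 1). *)
Definition lorentzian_form (R : realType) (n : nat) (G : 'M[R]_n) : Prop :=
  exists2 P : 'M[R]_n, P \in unitmx &
    P *m G *m P^T = diag_mx (\row_j (if (j : nat) == 0%N then -1 else 1)).

Record lorentzian_metric (R : realType) (n : nat) (M : manifold R n) :=
    LorentzianMetric {
  metric_comp :> atlas M -> 'rV[R]_n -> 'M[R]_n;
  metric_smooth : forall a, smooth_on (img a) (metric_comp a);
  metric_lorentzian : forall a u, img a u -> lorentzian_form (metric_comp a u);
  metric_compat : forall a b u, img a u -> dom b (param a u) ->
    metric_comp a u = 'J (locrep id a b) u *m metric_comp b (locrep id a b u)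
                        *m ('J (locrep id a b) u)^T }.

Definition gdot (R : realType) (n : nat) (G : 'M[R]_n) (x y : 'rV[R]_n) : R :=
  (x *m G *m y^T) 0 0.

(* The Levi-Civita connection in a chart: christoffel G u x y is the vector
   with components \Gamma^k_ij x^i y^j, where
   \Gamma^k_ij = 1/2 g^kl (d_i g_jl + d_j g_il - d_l g_ij). *)
Definition christoffel (R : realType) (n : nat) (G : 'rV[R]_n -> 'M[R]_n)
    (u x y : 'rV[R]_n) : 'rV[R]_n :=
  (\row_l (2^-1 * (gdot ('D_x G u) y 'e_l + gdot ('D_y G u) x 'e_l
                   - gdot ('D_('e_l) G u) x y))) *m invmx (G u).

Definition cov (R : realType) (n : nat) (G : 'rV[R]_n -> 'M[R]_n)
    (v : 'rV[R]_n) (Y : 'rV[R]_n -> 'rV[R]_n) (u : 'rV[R]_n) : 'rV[R]_n :=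
  'D_v Y u + christoffel G u v (Y u).

(* Covariant derivative in the direction v of a vector field W along a map F,
   i.e., of W u tangent to the ambient space at F u. *)
Definition cov_along (R : realType) (m n : nat) (G : 'rV[R]_n -> 'M[R]_n)
    (F : 'rV[R]_m -> 'rV[R]_n) (v : 'rV[R]_m) (W : 'rV[R]_m -> 'rV[R]_n)
    (u : 'rV[R]_m) : 'rV[R]_n :=
  'D_v W u + christoffel G (F u) (v *m 'J F u) (W u).

Definition lie_bracket (R : realType) (n : nat) (X Y : 'rV[R]_n -> 'rV[R]_n)
    (u : 'rV[R]_n) : 'rV[R]_n :=
  'D_(X u) Y u - 'D_(Y u) X u.

Definition riemann (R : realType) (n : nat) (G : 'rV[R]_n -> 'M[R]_n)
    (X Y Z : 'rV[R]_n -> 'rV[R]_n) (u : 'rV[R]_n) : 'rV[R]_n :=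
  cov G (X u) (fun w => cov G (Y w) Z w) u
  - cov G (Y u) (fun w => cov G (X w) Z w) u
  - cov G (lie_bracket X Y u) Z u.

(* S(Y, Z) = trace (X |-> R(X, Y)Z). *)
Definition ricci (R : realType) (n : nat) (G : 'rV[R]_n -> 'M[R]_n)
    (Y Z : 'rV[R]_n -> 'rV[R]_n) (u : 'rV[R]_n) : R :=
  \sum_(k < n) riemann G (fun=> 'e_k) Y Z u 0 k.

Definition lie_metric (R : realType) (n : nat) (V : 'rV[R]_n -> 'rV[R]_n)
    (G : 'rV[R]_n -> 'M[R]_n) (Y Z : 'rV[R]_n -> 'rV[R]_n) (u : 'rV[R]_n) : R :=
  'D_(V u) (fun w => gdot (G w) (Y w) (Z w)) u
  - gdot (G u) (lie_bracket V Y u) (Z u) - gdot (G u) (Y u) (lie_bracket V Z u).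

(* In the next two definitions the tensor identities are tested on arbitrary
   smooth vector fields defined on chart domains. *)
Definition ricci_soliton (R : realType) (n : nat) (M : manifold R n)
    (g : atlas M -> 'rV[R]_n -> 'M[R]_n) (V : atlas M -> 'rV[R]_n -> 'rV[R]_n)
    (lambda : R) : Prop :=
  forall (a : atlas M) (Y Z : 'rV[R]_n -> 'rV[R]_n),
    smooth_on (img a) Y -> smooth_on (img a) Z ->
  forall u, img a u ->
    lie_metric (V a) (g a) Y Z u + 2 * ricci (g a) Y Z u
    + 2 * lambda * gdot (g a u) (Y u) (Z u) = 0.

(* Here eta is the 1-form metrically dual to the vector field V. *)
Definition eta_einstein (R : realType) (n : nat) (M : manifold R n)
    (g : atlas M -> 'rV[R]_n -> 'M[R]_n) (V : atlas M -> 'rV[R]_n -> 'rV[R]_n) :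
    Prop :=
  exists p q : M -> R,
    [/\ smooth_fun p, smooth_fun q &
      forall (a : atlas M) (Y Z : 'rV[R]_n -> 'rV[R]_n),
        smooth_on (img a) Y -> smooth_on (img a) Z ->
      forall u, img a u ->
        ricci (g a) Y Z u
        = p (param a u) * gdot (g a u) (Y u) (Z u)
          + q (param a u) * (gdot (g a u) (Y u) (V a u)
                             * gdot (g a u) (Z u) (V a u))].

Section LCS.

Variables (R : realType) (n : nat) (N : manifold R n).
Variables (g : lorentzian_metric N) (xi : vector_field N).

Definition eta (b : atlas N) (u v : 'rV[R]_n) : R := gdot (g b u) v (xi b u).

Definition phi (b : atlas N) (u v : 'rV[R]_n) : 'rV[R]_n :=
  v + eta b u v *: xi b u.

Definition rho (alpha : N -> R) (b : atlas N) (u : 'rV[R]_n) : R :=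
  - 'D_(xi b u) (alpha \o param b) u.

Record is_LCS (alpha : N -> R) : Prop := IsLCS {
  lcs_connected : connected [set: N];
  lcs_unit : forall b u, img b u -> gdot (g b u) (xi b u) (xi b u) = -1;
  lcs_alpha_smooth : smooth_fun alpha;
  lcs_alpha_neq0 : forall p, alpha p != 0;
  lcs_nabla_xi : forall b u v, img b u ->
    cov (g b) v (xi b) u = alpha (param b u) *: phi b u v;
  lcs_dalpha : forall b u v, img b u ->
    'D_v (alpha \o param b) u = rho alpha b u * eta b u v }.

Variables (m : nat) (M : manifold R m) (i : M -> N).

(* Injectively immersed submanifold. *)
Definition submanifold : Prop :=
  [/\ smooth_map i, injective i &
      forall (a : atlas M) (b : atlas N) u, img a u -> dom b (i (param a u)) ->
        row_free ('J (locrep i a b) u)].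

(* The tangent space of the submanifold is the row space of 'J (locrep i a b) u. *)
Definition invariant_submanifold : Prop :=
  forall (a : atlas M) (b : atlas N) u, img a u -> dom b (i (param a u)) ->
    let J := 'J (locrep i a b) u in
    (xi b (locrep i a b u) <= J)%MS /\
    forall v : 'rV[R]_n, (v <= J)%MS -> (phi b (locrep i a b u) v <= J)%MS.

(* The components of the next two tensors do not depend on the chart b used on
   the ambient manifold. *)
Definition induced_metric (a : atlas M) (u : 'rV[R]_m) : 'M[R]_m :=
  let b := chart_at N (i (param a u)) in
  let J := 'J (locrep i a b) u in
  J *m g b (locrep i a b u) *m J^T.

(* The field on M whose image under the differential of i is xi, when xi is
   tangent to M. *)
Definition restricted_xi (a : atlas M) (u : 'rV[R]_m) : 'rV[R]_m :=
  let b := chart_at N (i (param a u)) in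
  xi b (locrep i a b u) *m pinvmx ('J (locrep i a b) u).

(* h(X, Y) is the normal component of the ambient covariant derivative of Y
   along X; kermx (g *m J^T) spans the normal space. *)
Definition second_ff (a : atlas M) (b : atlas N) (X Y : 'rV[R]_m -> 'rV[R]_m)
    (u : 'rV[R]_m) : 'rV[R]_n :=
  let F := locrep i a b in
  cov_along (g b) F (X u) (fun w => Y w *m 'J F w) u
    *m proj_mx (kermx (g b (F u) *m ('J F u)^T)) <<'J F u>>%MS.

Definition mean_curvature (a : atlas M) (b : atlas N) (u : 'rV[R]_m) :
    'rV[R]_n :=
  m%:R^-1 *: \sum_(k < m) \sum_(l < m)
    invmx (induced_metric a u) k l *: second_ff a b (fun=> 'e_k) (fun=> 'e_l) u.

Definition minimal_submanifold : Prop :=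
  forall (a : atlas M) (b : atlas N) u, img a u -> dom b (i (param a u)) ->
    mean_curvature a b u = 0.

End LCS.

(* Main.v *)
Require Import Defs.
From HB Require Import structures.
From mathcomp Require Import all_boot all_order all_algebra.
From mathcomp Require Import all_classical all_reals all_analysis.
From mathcomp Require Import ring lra.

Set Implicit Arguments.
Unset Strict Implicit.
Unset Printing Implicit Defensive.

Import Order.TTheory GRing.Theory Num.Theory.
Import numFieldNormedType.Exports.
Local Open Scope classical_set_scope.
Local Open Scope ring_scope.

(** Why the theorem holds.  On an invariant submanifold M the field xi is
tangent, so the ambient identity nabla_X xi = alpha (X + eta(X) xi) has no
normal part for X tangent to M.  By the Gauss formula the same identity holds
for the connection of M ([induced_nabla_xi], [overlap_concircular]) and
h(X, xi) = 0 ([second_ff_xi]).  Since nabla xi is symmetric, the Lie derivative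
of g along xi is 2 alpha (g + eta (x) eta), and the soliton equation becomes
S = -(alpha + lambda) g - alpha eta (x) eta: this is the eta-Einstein condition.

Minimality holds because such a soliton can only live on a curve.  The Ricci
identity gives R(X, Y) xi = (alpha^2 - rho) (eta(Y) X - eta(X) Y), and comparing
S(xi, xi) with the formula for S above gives (m - 1) (alpha^2 - rho) = -lambda
([ricci_xi_xi]).  The contracted Bianchi identity 2 div S = dr, applied to that
same formula, gives (m - 1) (rho - 2 alpha^2) = 0 ([bianchi_xi]).  Adding the
two, (m - 1) alpha^2 = lambda is constant; as d alpha = rho eta, this forces
(m - 1) alpha rho = 0 and hence 2 (m - 1) alpha^3 = 0 ([concircular_soliton]).
The function alpha vanishes nowhere, so m = 1.  Then xi spans the tangent space
of M, and h(X, xi) = 0 says that h = 0.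

The tensor calculus takes place in a commutative ring with commuting
derivations, where the Leibniz rule has no differentiability side conditions.
In the application this is the ring of smooth functions on an open subset of
R^m ([smoothring]), and the derivations commute by Young's theorem
([derive_comm]).  Restricting the ambient metric, field and function to M gives
elements of this ring whose derivatives are computed by the chain rule. *)

(** * Lorentzian scalar products *)

Section Lorentz.
Variables (R : realType) (n : nat).
Implicit Types (G : 'M[R]_n) (x v : 'rV[R]_n).

Lemma lorentzian_sym G : lorentzian_form G -> G^T = G.
Proof.
move=> [P uP E]; have uPt : P^T \in unitmx by rewrite unitmx_tr.
apply: (can_inj (mulKmx uP)); apply: (can_inj (mulmxK uPt)).
have -> : P *m G^T *m P^T = (P *m G *m P^T)^T.
  by rewrite !trmx_mul trmxK mulmxA.
by rewrite E tr_diag_mx.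
Qed.

Lemma lorentzian_unit G : lorentzian_form G -> G \in unitmx.
Proof.
move=> [P uP E]; have : P *m G *m P^T \in unitmx.
  rewrite E unitmxE det_diag unitfE; apply/prodf_neq0 => j _.
  by rewrite mxE; case: ifP; rewrite ?oppr_eq0 oner_eq0.
by rewrite !unitmx_mul => /andP[/andP[_ ->]].
Qed.

Lemma gdotDl G x y v : gdot G (x + y) v = gdot G x v + gdot G y v.
Proof. by rewrite /gdot !mulmxDl mxE. Qed.

Lemma gdotZl G c x v : gdot G (c *: x) v = c * gdot G x v.
Proof. by rewrite /gdot -!scalemxAl mxE. Qed.

Lemma gdotDr G x y v : gdot G x (y + v) = gdot G x y + gdot G x v.
Proof. by rewrite /gdot raddfD /= mulmxDr mxE. Qed.

Lemma gdotZr G c x v : gdot G x (c *: v) = c * gdot G x v.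
Proof. by rewrite /gdot linearZ /= -scalemxAr mxE. Qed.
Lemma gdot_base G j k : gdot G 'e_j 'e_k = G j k.
Proof. by rewrite /gdot -rowE trmx_delta -colE !mxE. Qed.
Lemma gdotBl G x y v : gdot G (x - y) v = gdot G x v - gdot G y v.
Proof. by rewrite -scaleN1r gdotDl gdotZl mulN1r. Qed.

Lemma gdotBr G x y v : gdot G x (y - v) = gdot G x y - gdot G x v.
Proof. by rewrite -scaleN1r gdotDr gdotZr mulN1r. Qed.

Lemma gdot_mxD G G' x v : gdot (G + G') x v = gdot G x v + gdot G' x v.
Proof. by rewrite /gdot mulmxDr mulmxDl mxE. Qed.

Lemma gdot_mxZ G c x v : gdot (c *: G) x v = c * gdot G x v.
Proof. by rewrite /gdot -scalemxAr -scalemxAl mxE. Qed.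

Lemma gdot_dyad (w x v : 'rV[R]_n) :
  gdot (w^T *m w) x v = (x *m w^T) 0 0 * (v *m w^T) 0 0.
Proof.
rewrite /gdot mulmxA -mulmxA mxE big_ord1; congr (_ * _).
transitivity ((v *m w^T)^T 0 0); last by rewrite mxE.
by rewrite trmx_mul trmxK.
Qed.

Lemma gdotC G x v : G^T = G -> gdot G x v = gdot G v x.
Proof.
move=> Gs; rewrite /gdot -[RHS](mxE trmx_key (fun i j => (v *m G *m x^T) j i)).
by rewrite -/(trmx _) !trmx_mul trmxK Gs mulmxA.
Qed.

(** A reversed Cauchy-Schwarz inequality.  Write x = (x0, a) and v = (v0, b) in
an orthonormal frame.  The two equalities give
sum_k (x0 b_k - v0 a_k)^2 = v0^2 (|a|^2 - x0^2), where the last factor is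
negative because x is timelike; so v0 = 0, and then b = 0. *)
Lemma orthogonal_timelike_null G x v : lorentzian_form G ->
  gdot G x x < 0 -> gdot G x v = 0 -> gdot G v v = 0 -> v = 0.
Proof.
move=> [P uP E].
case: n G x v P uP E => [|n'] G x v P uP E; first by move=> *; apply/rowP => -[].
have key y z : gdot G y z = - ((y *m invmx P) 0 ord0 * (z *m invmx P) 0 ord0)
    + \sum_(k < n') (y *m invmx P) 0 (lift ord0 k) * (z *m invmx P) 0 (lift ord0 k).
  have -> : gdot G y z = gdot (P *m G *m P^T) (y *m invmx P) (z *m invmx P).
    rewrite /gdot trmx_mul !mulmxA mulmxKV// -(mulmxA _ P^T) -trmx_mul.
    by rewrite mulVmx// trmx1 mulmx1.
  rewrite E /gdot mul_mx_diag mxE big_ord_recl !mxE /=; congr (_ + _).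
    by rewrite mulrN1 mulNr.
  by apply: eq_bigr => k _; rewrite !mxE /= mulr1.
rewrite !key; set X := x *m _; set W := v *m _ => x0 xv vv.
pose a k := X 0 (lift ord0 k); pose b k := W 0 (lift ord0 k).
have S : \sum_k (X 0 0 * b k - W 0 0 * a k) ^+ 2 =
    W 0 0 ^+ 2 * (- (X 0 0 * X 0 0) + \sum_k a k * a k).
  rewrite mulrDr mulr_sumr.
  transitivity (X 0 0 ^+ 2 * \sum_k b k * b k - 2 * X 0 0 * W 0 0 * (\sum_k a k * b k)
      + \sum_k W 0 0 ^+ 2 * (a k * a k)).
    rewrite !mulr_sumr -sumrB -big_split; apply: eq_bigr => k _ /=; ring.
  have -> : \sum_k b k * b k = W 0 0 * W 0 0.
    by apply/eqP; rewrite -subr_eq0 addrC; apply/eqP.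
  have -> : \sum_k a k * b k = X 0 0 * W 0 0.
    by apply/eqP; rewrite -subr_eq0 addrC; apply/eqP.
  ring.
have W00 : W 0 0 = 0.
  apply/eqP/negPn/negP => W0.
  have : W 0 0 ^+ 2 * (- (X 0 0 * X 0 0) + \sum_k a k * a k) < 0.
    by rewrite nmulr_llt0// exprn_even_gt0.
  by rewrite -S ltNge sumr_ge0// => k _; exact: sqr_ge0.
have b0 k : b k = 0.
  have : \sum_k b k ^+ 2 = 0.
    have := vv; rewrite [W 0 ord0]W00 mul0r oppr0 add0r => {}vv.
    by rewrite -[RHS]vv; apply: eq_bigr => j _; rewrite expr2.
  move=> /eqP; rewrite psumr_eq0 => [/allP/(_ k (mem_index_enum _))|j _].
    by rewrite /= sqrf_eq0 => /eqP.
  exact: sqr_ge0.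
have : W = 0.
  apply/rowP => j; rewrite [RHS]mxE.
  by case: (unliftP ord0 j) => [k ->|->]; [exact: b0|exact: W00].
by rewrite /W => /(congr1 (mulmx^~ P)); rewrite mulmxKV// mul0mx.
Qed.

Section TimelikeSubspace.
Variables (m : nat) (G : 'M[R]_n) (J : 'M[R]_(m, n)) (x : 'rV[R]_n).
Hypotheses (lG : lorentzian_form G) (xJ : (x <= J)%MS) (x0 : gdot G x x < 0).

(** A vector both in J and normal to J is null and orthogonal to x.  So the
metric induced on J is nondegenerate, and J is complementary to its normal
space. *)
Lemma timelike_normal_eq0 v : (v <= J)%MS -> v *m (G *m J^T) = 0 -> v = 0.
Proof.
move=> vJ vn; have N w : (w <= J)%MS -> gdot G v w = 0.
  move=> /submxP[D ->]; rewrite /gdot trmx_mul mulmxA -(mulmxA v) vn mul0mx mxE //.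
apply: (orthogonal_timelike_null lG x0); last exact: N.
by rewrite gdotC ?N//; exact: lorentzian_sym.
Qed.

Lemma timelike_gram_unit : row_free J -> J *m G *m J^T \in unitmx.
Proof.
move=> fJ; rewrite -row_free_unit; apply: inj_row_free => w w0.
apply: (row_free_inj fJ); rewrite mul0mx.
apply: timelike_normal_eq0; first exact: submxMl.
by rewrite !mulmxA in w0 *.
Qed.

Lemma timelike_normal_cap : (kermx (G *m J^T) :&: <<J>>)%MS = 0.
Proof.
apply/eqP; rewrite -submx0; apply/rV_subP => v.
rewrite sub_capmx genmxE => /andP[/sub_kermxP v0 vJ].
by rewrite (timelike_normal_eq0 vJ v0) sub0mx.
Qed.
End TimelikeSubspace.
End Lorentz.

(** * Derivatives *)

Section Differentiable.
Variable R : realType.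

Lemma near_eq_differentiable (V W : normedModType R) (f g : V -> W) x :
  {near x, f =1 g} -> differentiable f x -> differentiable g x.
Proof.
move=> fg df.
have fgx : f x = g x := nbhs_singleton fg.
have E : g \o shift x = cst (g x) + 'd f x +o_ 0 id.
  apply/eqaddoP => e e0.
  have /eqaddoP /(_ _ e0) := diff_locally df.
  have fg0 : \forall h \near 0, f (h + x) = g (h + x).
    by have := fg; rewrite (near_shift 0 x) subr0.
  apply: filterS2 fg0 => h fgh /=.
  by rewrite /= !fctE /= fgh fgx.
have dE := diff_unique (diff_continuous df) E.
by apply/diff_locallyP; rewrite dE; split => //; exact: diff_continuous.
Qed.

Lemma is_derive_line (V : normedModType R) (f : V -> R) (a w : V) (s : R) :
  differentiable f (s *: a + w) ->
  is_derive s 1 (fun t : R => f (t *: a + w)) ('D_a f (s *: a + w)).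
Proof.
move=> df; have dl : is_diff s (fun t : R => t *: a + w) (fun h => h *: a).
  by apply: is_diff_eq; apply/funext => h; rewrite /= addr0.
have dc : differentiable (fun t : R => f (t *: a + w)) s.
  by apply: (@differentiable_comp _ _ _ _ (fun t : R => t *: a + w)).
apply: DeriveDef; first exact: diff_derivable.
rewrite !deriveE // (@diff_comp _ _ _ _ (fun t : R => t *: a + w) f) //=.
by rewrite diff_val scale1r.
Qed.

(** By the mean value theorem in the direction a, the second difference is t
times the increment of 'D_a f between two points near u that differ by t b.
Differentiability of 'D_a f at u alone suffices to estimate that increment,
since both of its end points are compared with the same linear map. *)
Lemma second_difference (V : normedModType R) (f : V -> R) (a b u : V)
    (U : set V) (e : R) :
  nbhs u U -> (forall v, U v -> differentiable f v) ->
  differentiable ('D_a f) u -> 0 < e ->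
  exists2 d : R, 0 < d & forall t, 0 < t -> t < d ->
    `|f (t *: a + (t *: b + u)) - f (t *: a + u)
       - (f (t *: b + u) - f u) - t ^+ 2 * 'D_b ('D_a f) u| <= e * t ^+ 2.
Proof.
move=> Uu df dDf e0.
pose K := 2 * `|a| + `|b| + 1.
have K0 : 0 < K by rewrite /K; have := normr_ge0 a; have := normr_ge0 b; lra.
have /eqaddoP /(_ _ (divr_gt0 e0 K0)) := diff_locally dDf.
have : \forall h \near 0, U (h + u).
  by have : \near u, U u := Uu; rewrite (near_shift 0 u) subr0.
move=> /nbhs_norm0P[d1 d10 UP] /nbhs_norm0P[d2 d20 EP].
pose d := Num.min d1 d2 / K.
have d0 : 0 < d by rewrite divr_gt0// lt_min d10.
exists d => // t t0 td.
have tK : t * K < Num.min d1 d2 by move: td; rewrite /d ltr_pdivlMr.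
move: tK; rewrite lt_min => /andP[tK1 tK2].
have small1 c : 0 <= c -> c <= t -> `|c *: a| <= t * `|a|.
  by move=> c0 ct; rewrite normrZ ger0_norm// ler_wpM2r.
have small2 c : 0 <= c -> c <= t -> `|c *: a + t *: b| <= t * (`|a| + `|b|).
  move=> c0 ct; rewrite (le_trans (ler_normD _ _))// mulrDr lerD ?small1//.
  by rewrite normrZ gtr0_norm.
have an := normr_ge0 a; have bn := normr_ge0 b.
have le1 : t * `|a| < t * K by rewrite ltr_pM2l// /K; lra.
have le2 : t * (`|a| + `|b|) < t * K by rewrite ltr_pM2l// /K; lra.
pose phi s := f (s *: a + (t *: b + u)) - f (s *: a + u).
pose dphi s := 'D_a f (s *: a + (t *: b + u)) - 'D_a f (s *: a + u).
have phi' s : 0 <= s -> s <= t -> is_derive s 1 phi (dphi s).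
  move=> s0 st; apply: is_deriveB; apply: is_derive_line; apply: df.
    rewrite addrA; apply: UP; exact: le_lt_trans (small2 _ s0 st) (lt_trans le2 tK1).
  by apply: UP; exact: le_lt_trans (small1 _ s0 st) (lt_trans le1 tK1).
have cphi : {within `[0, t], continuous phi}.
  apply: derivable_within_continuous => s; rewrite in_itv /= => /andP[s0 st].
  by have := phi' s s0 st => ?.
have dphi0 s : s \in `]0, t[%R -> is_derive s 1 phi (dphi s).
  by rewrite in_itv /= => /andP[s0 st]; apply: phi'; exact: ltW.
have [c c0t E] := MVT t0 dphi0 cphi.
move: c0t; rewrite in_itv /= => /andP[/ltW c0 /ltW ct].
have -> : f (t *: a + (t *: b + u)) - f (t *: a + u)
       - (f (t *: b + u) - f u) = t * dphi c.
  by rewrite mulrC -[t in RHS]subr0 -E /phi !scale0r !add0r.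
have B1 := small2 _ c0 ct; have B2 := small1 _ c0 ct.
have := EP _ (le_lt_trans B1 (lt_trans le2 tK2)).
have := EP _ (le_lt_trans B2 (lt_trans le1 tK2)).
have dl : 'd ('D_a f) u (c *: a + t *: b) =
    c * 'd ('D_a f) u a + t * 'D_b ('D_a f) u by rewrite deriveE// linearP linearZ.
rewrite !fctE /= dl linearZ /= -[c *: a + _ + u]addrA.
set p := 'd _ _ a; set q := 'D_b _ _; rewrite /dphi.
set r := 'D_a f u; set x := 'D_a f (c *: a + u).
set y := 'D_a f (c *: a + (t *: b + u)).
move=> X Y.
have {}X : `|x - (r + c * p)| <= e / K * (t * `|a|).
  by apply: le_trans X _; rewrite ler_wpM2l// divr_ge0 ?ltW.
have {}Y : `|y - (r + (c * p + t * q))| <= e / K * (t * (`|a| + `|b|)).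
  by apply: le_trans Y _; rewrite ler_wpM2l// divr_ge0 ?ltW.
have -> : t * (y - x) - t ^+ 2 * q =
    t * ((y - (r + (c * p + t * q))) - (x - (r + c * p))) by ring.
rewrite normrM gtr0_norm// expr2 mulrA (mulrC e) -mulrA ler_pM2l//.
apply: le_trans (ler_normB _ _) _; apply: le_trans (lerD Y X) _.
rewrite -mulrDr -mulrDr -mulrA ler_pM2l//.
rewrite mulrCA ger_pMr// mulrC ler_pdivrMr// mul1r /K; lra.
Qed.

(** Young's theorem: the second difference is symmetric in a and b, and divided
by t^2 it tends to either mixed derivative. *)
Lemma derive_comm (V : normedModType R) (f : V -> R) (a b u : V) (U : set V) :
  nbhs u U -> (forall v, U v -> differentiable f v) ->
  differentiable ('D_a f) u -> differentiable ('D_b f) u ->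
  'D_b ('D_a f) u = 'D_a ('D_b f) u.
Proof.
move=> Uu df da db; apply/eqP; rewrite -subr_eq0 -normr_le0.
apply/ler_addgt0Pr => e e0; rewrite add0r.
have e20 : 0 < e / 2 by rewrite divr_gt0.
have [d1 d10 H1] := @second_difference _ f a b u U _ Uu df da e20.
have [d2 d20 H2] := @second_difference _ f b a u U _ Uu df db e20.
pose t := Num.min d1 d2 / 2.
have m0 : 0 < Num.min d1 d2 by rewrite lt_min d10.
have t0 : 0 < t by rewrite divr_gt0.
have : t < Num.min d1 d2 by rewrite /t ltr_pdivrMr// ltr_pMr// ltr1n.
rewrite lt_min => /andP[/(H1 t t0) {}H1 /(H2 t t0)].
rewrite (addrCA (t *: b)); set F := f (_ + (_ + _)) in H1 *.
move: H1; set x := 'D_b _ u; set y := 'D_a _ u => {}H1 {}H2.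
rewrite -(@ler_pM2r _ (t ^+ 2)) ?exprn_gt0//.
rewrite -[X in _ * X]gtr0_norm ?exprn_gt0// -normrM.
set A := (X in `|X|) in H1; set B := (X in `|X|) in H2.
have -> : (x - y) * t ^+ 2 = B - A by rewrite /A /B; ring.
apply: le_trans (ler_normB _ _) _; apply: le_trans (lerD H2 H1) _.
by rewrite le_eqVlt; apply/orP; left; apply/eqP; field.
Qed.
End Differentiable.

Lemma derive_sum_base (R : realType) n (V : normedModType R) (f : 'rV[R]_n -> V) u v :
  differentiable f u -> 'D_v f u = \sum_k v 0 k *: 'D_('e_k) f u.
Proof.
move=> df; rewrite (deriveE _ df).
transitivity ('d f u (\sum_j v 0 j *: 'e_j)); first by rewrite -row_sum_delta.
by rewrite linear_sum; apply: eq_bigr => j _; rewrite linearZ (deriveE _ df).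
Qed.

(** * Smooth functions *)

Section Smooth.
Variable R : realType.

Lemma open_near_eq n (V : normedModType R) (U : set 'rV[R]_n)
    (f g : 'rV[R]_n -> V) u :
  open U -> U u -> (forall w, U w -> f w = g w) -> {near u, f =1 g}.
Proof.
by move=> oU Uu fg; apply: filterS (open_nbhs_nbhs (conj oU Uu)) => w /fg.
Qed.

Lemma smooth_differentiable n (V : normedModType R) (U : set 'rV[R]_n)
    (f : 'rV[R]_n -> V) u : smooth_on U f -> U u -> differentiable f u.
Proof. by move=> sf Uu; exact: (sf [::]). Qed.

Lemma smooth_partial n (V : normedModType R) (U : set 'rV[R]_n)
    (f : 'rV[R]_n -> V) i : smooth_on U f -> smooth_on U ('D_('e_i) f).
Proof.
by move=> sf s u Uu; have := sf (rcons s i) u Uu; rewrite /iter_partial foldr_rcons.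
Qed.

(** Coinduction: smoothness is the largest property implying differentiability
and stable under partial derivatives.  This replaces inductions on the order of
differentiation, in which product and chain rules would have to be iterated. *)
Lemma smooth_coind n (V : normedModType R) (U : set 'rV[R]_n)
    (P : ('rV[R]_n -> V) -> Prop) :
  open U ->
  (forall f u, P f -> U u -> differentiable f u) ->
  (forall f i, P f -> exists2 g, P g & forall u, U u -> 'D_('e_i) f u = g u) ->
  forall f, P f -> smooth_on U f.
Proof.
move=> oU Pd PD f Pf s.
have [g Pg fg] : exists2 g, P g & forall u, U u -> iter_partial s f u = g u.
  elim: s => [|i s [g Pg fg]]; first by exists f.
  have [h Ph gh] := PD _ i Pg; exists h => // u Uu; rewrite -gh//=.
  exact/near_eq_derive/(open_near_eq oU Uu fg).
move=> u Uu; apply: near_eq_differentiable (Pd _ _ Pg Uu).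
by apply: (open_near_eq oU Uu) => w Uw; rewrite fg.
Qed.

Lemma smooth_on_ext n (V : normedModType R) (U : set 'rV[R]_n)
    (f g : 'rV[R]_n -> V) :
  open U -> (forall u, U u -> f u = g u) -> smooth_on U f -> smooth_on U g.
Proof.
move=> oU fg sf.
pose P h := exists2 k, smooth_on U k & forall u : 'rV[R]_n, U u -> k u = h u :> V.
apply: (@smooth_coind n V U P oU); last by exists f.
- move=> h u [k sk kh] Uu.
  exact: near_eq_differentiable (open_near_eq oU Uu kh) (smooth_differentiable sk Uu).
- move=> h i [k sk kh]; exists ('D_('e_i) k).
    by exists ('D_('e_i) k) => //; exact: smooth_partial.
  by move=> u Uu; apply/esym/near_eq_derive/(open_near_eq oU Uu kh).
Qed.

Lemma smooth_on_local n (V : normedModType R) (U : set 'rV[R]_n)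
    (f : 'rV[R]_n -> V) :
  (forall u, U u -> exists2 W, open W /\ W u & smooth_on W f) -> smooth_on U f.
Proof. by move=> H s u /H[W [_ Wu]]; apply. Qed.

Lemma smooth_on_cst n (V : normedModType R) (U : set 'rV[R]_n) (c : V) :
  smooth_on U (fun=> c).
Proof.
move=> s u _; have [d ->] : exists d, iter_partial s (fun=> c) = (fun=> d).
  elim: s => [|i s [d ds]]; first by exists c.
  by exists 0; apply/funext => w; rewrite /= -/(iter_partial s _) ds derive_cst.
exact: differentiable_cst.
Qed.

Lemma derive_coord (V : normedModType R) p q (f : V -> 'M[R]_(p, q)) i j u v :
  derivable f u v -> 'D_v (fun w => f w i j) u = ('D_v f u) i j.
Proof. by move=> df; rewrite derive_mx// mxE. Qed.

Lemma smooth_on_coord n p q (U : set 'rV[R]_n) (f : 'rV[R]_n -> 'M[R]_(p, q)) i j :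
  open U -> smooth_on U f -> smooth_on U (fun u => f u i j).
Proof.
move=> oU.
pose P h := exists2 k, smooth_on U k & h = fun u : 'rV[R]_n => (k u : 'M[R]_(p, q)) i j.
move=> sf; apply: (@smooth_coind n _ U P oU); last by exists f.
- move=> h u [k sk ->] Uu.
  apply: (@differentiable_comp _ _ _ _ k (fun N => N i j)).
    exact: smooth_differentiable Uu.
  exact: differentiable_coord.
- move=> h l [k sk ->]; exists (fun u => ('D_('e_l) k u) i j).
    by exists ('D_('e_l) k) => //; exact: smooth_partial.
  move=> u Uu; apply: derive_coord; apply: diff_derivable.
  exact: smooth_differentiable Uu.
Qed.

Section ScalarAlgebra.
Variables (n : nat) (U : set 'rV[R]_n).
Hypothesis oU : open U.

(** All the operations are put in a single class because the derivative of an
expression of one kind is an expression of other kinds (for instance the chain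
rule produces sums of products), so that only the whole class is stable under
partial derivatives. *)
Inductive smooth_expr : ('rV[R]_n -> R) -> Prop :=
| se_base f : smooth_on U f -> smooth_expr f
| se_add f g : smooth_expr f -> smooth_expr g -> smooth_expr (fun u => f u + g u)
| se_mul f g : smooth_expr f -> smooth_expr g -> smooth_expr (fun u => f u * g u)
| se_inv f : (forall u, U u -> f u != 0) -> smooth_expr f ->
    smooth_expr (fun u => (f u)^-1)
| se_comp k (W : set 'rV[R]_k) (F : 'rV[R]_n -> 'rV[R]_k) f :
    smooth_on U F -> (forall u, U u -> W (F u)) -> smooth_on W f ->
    smooth_expr (f \o F).

Lemma smooth_expr_diff f u : smooth_expr f -> U u -> differentiable f u.
Proof.
move=> sf Uu; elim: sf => {f} [f|f g _ df _ dg|f g _ df _ dg|f f0 _ df|k W F f sF WF sf].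
- by move=> /smooth_differentiable; apply.
- exact: differentiableD.
- exact: differentiableM.
- by apply: differentiableV => //; exact: f0.
- apply: differentiable_comp; first exact: smooth_differentiable Uu.
  exact: smooth_differentiable (WF _ Uu).
Qed.

Lemma derive_comp k (F : 'rV[R]_n -> 'rV[R]_k) (f : 'rV[R]_k -> R) u v :
  differentiable F u -> differentiable f (F u) ->
  'D_v (f \o F) u = \sum_j ('D_v F u) 0 j * 'D_('e_j) f (F u).
Proof.
move=> dF df; have dfF := differentiable_comp dF df.
rewrite (deriveE _ dfF) (diff_comp dF df) /= -(deriveE _ df) -(deriveE _ dF).
exact: derive_sum_base.
Qed.

Lemma smooth_expr_partial f i : smooth_expr f ->
  exists2 g, smooth_expr g & forall u, U u -> 'D_('e_i) f u = g u.
Proof.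
elim=> {f} [f sf|f g ef [f' ef' Df] eg [g' eg' Dg]|
  f g ef [f' ef' Df] eg [g' eg' Dg]|f f0 ef [f' ef' Df]|k W F f sF WF sf].
- by exists ('D_('e_i) f) => //; apply: se_base; exact: smooth_partial.
- exists (fun u => f' u + g' u) => [|u Uu]; first exact: se_add.
  by rewrite deriveD ?Df ?Dg//; exact/diff_derivable/smooth_expr_diff.
- exists (fun u => f u * g' u + g u * f' u) => [|u Uu].
    by apply: se_add; exact: se_mul.
  by rewrite deriveM ?Df ?Dg//; exact/diff_derivable/smooth_expr_diff.
- exists (fun u => (-1) * f' u * ((f u)^-1 * (f u)^-1)) => [|u Uu].
    apply: se_mul; first by apply: se_mul => //; apply/se_base/smooth_on_cst.
    by apply: se_mul; exact: se_inv.
  rewrite deriveV ?Df ?f0//; last exact/diff_derivable/smooth_expr_diff.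
  by transitivity (- (f u)^-1 ^+ 2 * f' u); [rewrite exprVn | ring].
- exists (fun u => \sum_j ('D_('e_i) F u) 0 j * 'D_('e_j) f (F u)) => [|u Uu].
    have : forall s : seq 'I_k, smooth_expr
      (fun u => \sum_(j <- s) ('D_('e_i) F u) 0 j * 'D_('e_j) f (F u)).
      elim=> [|j s IH].
        under eq_fun do rewrite big_nil; exact/se_base/smooth_on_cst.
      under eq_fun do rewrite big_cons; apply: se_add => //; apply: se_mul.
        apply: se_base; apply: (@smooth_on_coord n 1 k U ('D_('e_i) F)) => //.
        exact: smooth_partial.
      exact: (@se_comp k W F ('D_('e_j) f) sF WF (smooth_partial j sf)).
    by apply.
  apply: derive_comp; first exact: smooth_differentiable Uu.
  exact: smooth_differentiable (WF _ Uu).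
Qed.

Lemma smooth_exprW f : smooth_expr f -> smooth_on U f.
Proof.
apply: (smooth_coind oU) f => [f u ef Uu|f i ef]; first exact: smooth_expr_diff Uu.
exact: smooth_expr_partial.
Qed.
End ScalarAlgebra.

End Smooth.

(** * The ring of smooth functions on an open set *)

Record pointed_open (R : realType) (n : nat) := PointedOpen {
  po_set : set 'rV[R]_n;
  po_point : 'rV[R]_n;
  po_open : open po_set;
  po_mem : po_set po_point }.

Arguments po_open {R n} p.
Arguments po_mem {R n} p.

Section SmoothRing.
Variables (R : realType) (n : nat) (S : pointed_open R n).
Let U := po_set S.
Let oU : open U := po_open S.

(** Equations hold on the open set only, so each function on it must have a
unique representative.  The value outside the set is the one at the base point:
with the value 0, the constant function 1 would not be a representative. *)
Definition smooth_pred : {pred ('rV[R]_n -> R)} :=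
  mem [set f | smooth_on U f /\ forall u, ~ U u -> f u = f (po_point S)].

Record smoothring := SmoothRing {
  smoothring_fun :> 'rV[R]_n -> R;
  _ : smoothring_fun \in smooth_pred }.

HB.instance Definition _ := [isSub for smoothring_fun].
HB.instance Definition _ := [Choice of smoothring by <:].

Lemma smooth_pred_subring : subring_closed smooth_pred.
Proof.
have D (f g : 'rV[R]_n -> R) : smooth_on U f -> smooth_on U g ->
    smooth_on U (fun u => f u + g u).
  by move=> sf sg; apply: (smooth_exprW oU); apply: se_add; exact: se_base.
have M (f g : 'rV[R]_n -> R) : smooth_on U f -> smooth_on U g ->
    smooth_on U (fun u => f u * g u).
  by move=> sf sg; apply: (smooth_exprW oU); apply: se_mul; exact: se_base.
split=> [|f g|f g]; rewrite !inE /=.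
- by split=> //; exact: smooth_on_cst.
- move=> [sf cf] [sg cg]; split; last by move=> u nu; rewrite !fctE cf// cg.
  apply: (@smooth_on_ext _ _ _ _ (fun u => f u + (-1) * g u)) => //.
    by move=> u _; rewrite mulN1r.
  by apply: D => //; apply: M => //; exact: smooth_on_cst.
- move=> [sf cf] [sg cg]; split; last by move=> u nu; rewrite !fctE cf// cg.
  exact: M.
Qed.
HB.instance Definition _ := GRing.isSubringClosed.Build _ smooth_pred smooth_pred_subring.
HB.instance Definition _ := [SubChoice_isSubComNzRing of smoothring by <:].

Lemma smoothring_smooth (f : smoothring) : smooth_on U f.
Proof. by case: f => f /=; rewrite inE => -[]. Qed.

Lemma smoothring_ext (f g : smoothring) : (forall u, U u -> f u = g u) -> f = g.
Proof.
move=> fg; apply/val_inj/funext => u /=; have [Uu|nu] := pselect (U u); first exact: fg.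
case: f g fg => f /= /[!inE] -[_ ->//] [g /= /[!inE] -[_ ->//]] fg.
by apply: fg; exact: po_mem.
Qed.

Definition retract u := if `[< U u >] then u else po_point S.

Lemma retractE u : U u -> retract u = u.
Proof. by rewrite /retract => /asboolT ->. Qed.

Lemma retract_smooth f : smooth_on U f -> (f \o retract) \in smooth_pred.
Proof.
move=> sf; rewrite inE; split.
  by apply: smooth_on_ext sf => // u Uu; rewrite /= retractE.
move=> u nu /=; congr f; rewrite [RHS]retractE; last exact: po_mem.
by rewrite /retract asboolF.
Qed.

Definition to_smoothring f (sf : smooth_on U f) := SmoothRing (retract_smooth sf).

Lemma to_smoothringE f (sf : smooth_on U f) u : U u -> to_smoothring sf u = f u.
Proof. by move=> Uu /=; rewrite retractE. Qed.

Definition partial i (f : smoothring) : smoothring :=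
  to_smoothring (smooth_partial i (smoothring_smooth f)).

Lemma partialE i f u : U u -> partial i f u = 'D_('e_i) f u.
Proof. exact: to_smoothringE. Qed.

Let smoothring_derivable (f : smoothring) u v : U u -> derivable f u v.
Proof. by move=> Uu; exact/diff_derivable/(smooth_differentiable (smoothring_smooth f)). Qed.

Lemma partial_is_additive i : zmod_morphism (partial i).
Proof.
move=> f g; apply: smoothring_ext => u Uu; rewrite partialE//.
transitivity (partial i f u - partial i g u) => //.
rewrite !partialE// -deriveB//; exact: smoothring_derivable.
Qed.
HB.instance Definition _ i :=
  GRing.isZmodMorphism.Build _ _ (partial i) (partial_is_additive i).

Lemma partialM i f g : partial i (f * g) = partial i f * g + f * partial i g.
Proof.
apply: smoothring_ext => u Uu; rewrite partialE//.
transitivity (partial i f u * g u + f u * partial i g u) => //.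
rewrite !partialE// [LHS](@deriveM _ _ f g); [|exact: smoothring_derivable..].
by rewrite addrC; congr (_ + _); exact: mulrC.
Qed.

Lemma partialC i j f : partial i (partial j f) = partial j (partial i f).
Proof.
apply: smoothring_ext => u Uu.
have E k l : partial k (partial l f) u = 'D_('e_k) ('D_('e_l) f) u.
  apply: etrans (partialE k (partial l f) Uu) _.
  by apply/near_eq_derive/(open_near_eq oU Uu) => w Uw; exact: partialE.
rewrite !E; have sf := smoothring_smooth f.
apply: (@derive_comm _ _ _ _ _ _ U) => //.
- exact: open_nbhs_nbhs.
- by move=> v; exact: smooth_differentiable.
- exact: smooth_differentiable (smooth_partial _ sf) Uu.
- exact: smooth_differentiable (smooth_partial _ sf) Uu.
Qed.

Definition ev u (f : smoothring) : R := f u.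
Arguments ev : simpl never.

Lemma ev_partial i (f : smoothring) u : U u -> ev u (partial i f) = 'D_('e_i) f u.
Proof. exact: partialE. Qed.

Lemma ev_is_additive u : zmod_morphism (ev u). Proof. by []. Qed.
Lemma ev_is_multiplicative u : monoid_morphism (ev u). Proof. by []. Qed.
HB.instance Definition _ u :=
  GRing.isZmodMorphism.Build _ _ (ev u) (ev_is_additive u).
HB.instance Definition _ u :=
  GRing.isMonoidMorphism.Build _ _ (ev u) (ev_is_multiplicative u).

Lemma smooth_on_inv (f : 'rV[R]_n -> R) : smooth_on U f ->
  (forall u, U u -> f u != 0) -> smooth_on U (fun u => (f u)^-1).
Proof. by move=> sf f0; apply: (smooth_exprW oU); apply: se_inv => //; exact: se_base. Qed.

Lemma smoothring_inv (f : smoothring) : (forall u, U u -> f u != 0) ->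
  exists g, f * g = 1.
Proof.
move=> f0; exists (to_smoothring (smooth_on_inv (smoothring_smooth f) f0)).
apply: smoothring_ext => u Uu.
transitivity (f u * to_smoothring (smooth_on_inv (smoothring_smooth f) f0) u) => //.
by rewrite to_smoothringE// divff// f0.
Qed.

Lemma smoothring_half : exists h : smoothring, h + h = 1.
Proof.
have [|h] := @smoothring_inv (1 + 1).
  by move=> u _; rewrite gt_eqF//; exact: (@ltr0Sn R 1).
by rewrite mulrDl mul1r => h1; exists h.
Qed.

(** Cramer's rule keeps the inverse matrix inside the ring. *)
Lemma smoothring_invmx m (G : 'M[smoothring]_m) :
  (forall u, U u -> map_mx (ev u) G \in unitmx) ->
  exists H, G *m H = 1%:M.
Proof.
move=> uG; have [|d dG] := @smoothring_inv (\det G).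
  by move=> u Uu; rewrite -[\det G u]/(ev u (\det G)) -det_map_mx -unitfE -unitmxE uG.
by exists (d *: \adj G); rewrite -scalemxAr mul_mx_adj scale_scalar_mx mulrC dG.
Qed.
End SmoothRing.
Arguments ev {R n S} u f : simpl never.
Arguments partial {R n S} i f : simpl never.

(** * Levi-Civita connection and Bianchi identity over a differential ring *)

Section DifferentialRing.
Variables (A : comNzRingType) (m : nat) (D : 'I_m -> {additive A -> A}).
Hypothesis DM : forall i a b, D i (a * b) = D i a * b + a * D i b.
Hypothesis DC : forall i j a, D i (D j a) = D j (D i a).
Variable half : A.
Hypothesis half2 : half + half = 1.

Local Notation dm i := (map_mx (D i)).

Lemma double_eq0 (a : A) : a + a = 0 -> a = 0.
Proof. by move=> a0; rewrite -[a]mul1r -half2 mulrDl -mulrDr a0 mulr0. Qed.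

Lemma derivation1 i : D i 1 = 0.
Proof.
have := DM i 1 1; rewrite !mulr1 mul1r => /eqP.
by rewrite -subr_eq0 opprD addNKr oppr_eq0 => /eqP.
Qed.

Lemma derivation_mulmx i p q r (B : 'M[A]_(p, q)) (C : 'M[A]_(q, r)) :
  dm i (B *m C) = dm i B *m C + B *m dm i C.
Proof.
apply/matrixP => s t; rewrite !mxE raddf_sum -big_split /=.
by apply: eq_bigr => k _; rewrite !mxE DM.
Qed.

Lemma derivation_mxC i j p q (B : 'M[A]_(p, q)) : dm i (dm j B) = dm j (dm i B).
Proof. by apply/matrixP => s t; rewrite !mxE DC. Qed.

Section LeviCivita.
Variables (G H : 'M[A]_m).
Hypothesis Gsym : G^T = G.
Hypothesis GH : G *m H = 1%:M.

Let HG : H *m G = 1%:M. Proof. exact: mulmx1C. Qed.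

Lemma inverse_metric_sym : H^T = H.
Proof.
rewrite -[LHS]mulmx1 -GH mulmxA -[in H^T *m _]Gsym -trmx_mul GH trmx1.
by rewrite mul1mx.
Qed.

(** The scalar products g(nabla_(e_i) e_j, e_l) of the coordinate fields. *)
Definition koszul i : 'M[A]_m :=
  \matrix_(j, l) (half * (D i (G j l) + D j (G i l) - D l (G i j))).

(** The Christoffel symbols, with Gamma^k_ij the entry (j, k) of the i-th
matrix: vector fields are row vectors, and matrices act on their right. *)
Definition levi_civita i : 'M[A]_m := koszul i *m H.

Lemma koszulC i j l : koszul i j l = koszul j i l.
Proof.
by rewrite !mxE (_ : G j i = G i j) 1?(addrC (D i _))// -[in LHS]Gsym mxE.
Qed.

Lemma levi_civitaC i j l : levi_civita i j l = levi_civita j i l.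
Proof.
by rewrite ![(_ *m _) _ _]mxE; apply: eq_bigr => k _; rewrite koszulC.
Qed.

Lemma levi_civitaG i : levi_civita i *m G = koszul i.
Proof. by rewrite -mulmxA HG mulmx1. Qed.

Lemma levi_civita_metric i : dm i G = levi_civita i *m G + G *m (levi_civita i)^T.
Proof.
rewrite -[G *m _]trmxK trmx_mul trmxK Gsym levi_civitaG.
apply/matrixP => j l; rewrite !mxE.
have Gs a b : G a b = G b a by rewrite -[in LHS]Gsym mxE.
rewrite (Gs l j) (Gs i l) (Gs i j) -mulrDr.
rewrite -[LHS]mul1r -half2; ring.
Qed.

End LeviCivita.

(* From here on the connection is known only by its two defining properties:
   it is free of torsion and compatible with the metric. *)
Section MetricConnection.
Variables (G H : 'M[A]_m).
Hypothesis Gsym : G^T = G.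
Hypothesis GH : G *m H = 1%:M.
Let HG : H *m G = 1%:M. Proof. exact: mulmx1C. Qed.
Variable Gam : 'I_m -> 'M[A]_m.
Hypothesis GamC : forall i j l, Gam i j l = Gam j i l.
Hypothesis dG : forall i, dm i G = Gam i *m G + G *m (Gam i)^T.

Lemma derive_inverse_metric i : dm i H = - ((Gam i)^T *m H + H *m Gam i).
Proof.
have : dm i (H *m G) *m H = 0.
  rewrite HG (_ : dm i _ = 0) ?mul0mx //; apply/matrixP => s t.
  by rewrite !mxE; case: (s == t); rewrite ?derivation1 ?raddf0.
rewrite derivation_mulmx dG mulmxDl -mulmxA GH mulmx1 mulmxDr mulmxDl.
rewrite -!mulmxA GH mulmx1 !mulmxA HG mul1mx => /eqP.
by rewrite addr_eq0 addrC => /eqP.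
Qed.

Definition curvature i j : 'M[A]_m :=
  dm i (Gam j) - dm j (Gam i) + Gam j *m Gam i - Gam i *m Gam j.

Lemma curvatureC i j : curvature i j = - curvature j i.
Proof. by rewrite /curvature; apply/matrixP=> s t; rewrite !mxE; ring. Qed.

Definition nabla i p (Y : 'M[A]_(p, m)) := dm i Y + Y *m Gam i.

Let addmxE p q (B C : 'M[A]_(p, q)) s t : (B + C) s t = B s t + C s t.
Proof. by rewrite mxE. Qed.
Let oppmxE p q (B : 'M[A]_(p, q)) s t : (- B) s t = - B s t.
Proof. by rewrite mxE. Qed.

Let scalemxE p q a (B : 'M[A]_(p, q)) s t : (a *: B) s t = a * B s t.
Proof. by rewrite mxE. Qed.

Lemma ricci_identity i j p (Y : 'M[A]_(p, m)) :
  nabla i (nabla j Y) - nabla j (nabla i Y) = Y *m curvature i j.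
Proof.
rewrite /nabla /curvature !map_mxD !derivation_mulmx !mulmxDl !mulmxDr !mulmxN !mulmxA.
rewrite (derivation_mxC j i Y).
by apply/matrixP => s t; rewrite !(addmxE, oppmxE); ring.
Qed.

(** The curvature is skew for G because the second derivatives of G commute. *)
Lemma curvature_metric i j : curvature i j *m G + (curvature i j *m G)^T = 0.
Proof.
have dd k l : dm k (dm l G) =
    (dm k (Gam l) + Gam l *m Gam k) *m G + Gam l *m G *m (Gam k)^T
    + ((dm k (Gam l) + Gam l *m Gam k) *m G)^T + Gam k *m G *m (Gam l)^T.
  rewrite dG map_mxD !derivation_mulmx !dG !trmx_mul !raddfD /= !trmx_mul Gsym.
  rewrite map_trmx ?(mulmxDl, mulmxDr) ?mulmxA.
  by apply/matrixP => s t; rewrite !(addmxE, oppmxE); ring.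
have : dm i (dm j G) - dm j (dm i G) = 0 by rewrite derivation_mxC subrr.
rewrite !dd => <-; rewrite /curvature !mulmxDl !mulNmx !raddfD /= !raddfN /=.
by apply/matrixP => s t; rewrite !(addmxE, oppmxE); ring.
Qed.

(** With one index raised, skewness with respect to the metric becomes the
antisymmetry of a matrix. *)
Definition upper_curvature i j : 'M[A]_m := H *m curvature i j.

Lemma upper_curvature_trN i j : (upper_curvature i j)^T = - upper_curvature i j.
Proof.
apply/eqP; rewrite -addr_eq0 addrC; apply/eqP.
have := congr1 (fun B => H *m B *m H) (curvature_metric i j).
rewrite mulmx0 mul0mx => <-.
rewrite mulmxDr mulmxDl -!mulmxA GH mulmx1 /upper_curvature; congr (_ + _).
by rewrite !trmx_mul Gsym (inverse_metric_sym Gsym GH) !mulmxA HG mul1mx.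
Qed.

Lemma upper_curvatureC i j : upper_curvature i j = - upper_curvature j i.
Proof. by rewrite /upper_curvature curvatureC mulmxN. Qed.

Lemma upper_curvature_tr i j : (upper_curvature i j)^T = upper_curvature j i.
Proof. by rewrite upper_curvature_trN -upper_curvatureC. Qed.

Lemma upper_curvature_anti i j a b : upper_curvature i j a b = - upper_curvature i j b a.
Proof. by rewrite -oppmxE -upper_curvature_trN [RHS]mxE. Qed.

(** The covariant derivative with respect to the two upper indices only.  The
correction terms for the form indices i and j cancel in the cyclic sum of the
Bianchi identity, as the connection has no torsion. *)
Definition nabla_upper_curvature k i j : 'M[A]_m :=
  dm k (upper_curvature i j) + (Gam k)^T *m upper_curvature i j + upper_curvature i j *m Gam k.

Lemma second_bianchi i j k :
  nabla_upper_curvature k i j + nabla_upper_curvature i j k + nabla_upper_curvature j k i = 0.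
Proof.
have E a b c : nabla_upper_curvature a b c =
    H *m (dm a (curvature b c) + curvature b c *m Gam a - Gam a *m curvature b c).
  rewrite /nabla_upper_curvature /upper_curvature; move: (curvature b c) => B.
  rewrite derivation_mulmx derive_inverse_metric !mulmxDr mulNmx mulmxDl mulmxN !mulmxA.
  by apply/matrixP => s t; rewrite !(addmxE, oppmxE); ring.
rewrite !E -!mulmxDr /curvature; set Z := (X in H *m X); suff -> : Z = 0.
  by rewrite mulmx0.
rewrite /Z !(map_mxB, map_mxD) !derivation_mulmx !(mulmxDr, mulmxDl, mulmxN, mulNmx).
rewrite !mulmxA (derivation_mxC k i) (derivation_mxC k j) (derivation_mxC i j).
by apply/matrixP => s t; rewrite !(addmxE, oppmxE) [RHS]mxE; ring.
Qed.

Lemma nabla_upper_curvatureC k i j a b :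
  nabla_upper_curvature k i j a b = nabla_upper_curvature k j i b a.
Proof.
have -> : nabla_upper_curvature k j i = (nabla_upper_curvature k i j)^T.
  rewrite /nabla_upper_curvature !linearD /= map_trmx -(upper_curvature_tr i j).
  move: (upper_curvature i j) => B; rewrite !trmx_mul trmxK.
  by rewrite addrAC.
by rewrite [RHS]mxE.
Qed.

(** The order of the indices is that of S(Y, Z) = trace (X |-> R(X, Y) Z). *)
Definition ricci_mx : 'M[A]_m := \matrix_(j, k) \sum_i curvature i j k i.

Definition upper_ricci : 'M[A]_m := H *m ricci_mx^T.

Lemma trace_upper_curvature p j : \sum_i upper_curvature i j p i = upper_ricci p j.
Proof.
rewrite mxE; under eq_bigr do rewrite mxE.
by rewrite exchange_big; apply: eq_bigr => l _; rewrite !mxE mulr_sumr.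
Qed.

(** 2 div S = dr.  Contract the upper indices of the second Bianchi identity
with k and i.  By antisymmetry the first two terms both give the divergence of
S, and the third one gives -dr up to Christoffel terms. *)
Lemma contracted_bianchi j :
  \sum_k D k (upper_ricci k j) + \sum_k \sum_p Gam k p k * upper_ricci p j
  - \sum_k \sum_p Gam j p k * upper_ricci p k = half * D j (\tr upper_ricci).
Proof.
have sumD k p : \sum_i nabla_upper_curvature k i j p i = D k (upper_ricci p j)
    + \sum_q Gam k q p * upper_ricci q j
    + \sum_i \sum_q upper_curvature i j p q * Gam k q i.
  have -> : \sum_q Gam k q p * upper_ricci q j =
      \sum_i \sum_q Gam k q p * upper_curvature i j q i.
    by rewrite exchange_big; apply: eq_bigr => q _; rewrite -trace_upper_curvature mulr_sumr.
  rewrite -trace_upper_curvature raddf_sum -!big_split; apply: eq_bigr => i _ /=.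
  rewrite !addmxE; congr (_ + _ + _); first by rewrite [LHS]mxE.
    by rewrite [LHS]mxE; apply: eq_bigr => q _; rewrite [in LHS]mxE.
  by rewrite [LHS]mxE.
pose s1 := \sum_k D k (upper_ricci k j) + \sum_k \sum_p Gam k p k * upper_ricci p j.
have S1 : \sum_k \sum_i nabla_upper_curvature k i j k i = s1.
  under eq_bigr do rewrite sumD.
  rewrite !big_split /= -[RHS]addr0; congr (_ + _).
  (* a skew tensor contracted with the symmetric lower indices of Gam *)
  rewrite exchange_big big1 // => i _ /=; apply: double_eq0.
  rewrite [X in X + _]exchange_big -big_split big1 // => k _ /=.
  rewrite -big_split big1 // => q _ /=.
  by rewrite upper_curvature_anti GamC mulNr addNr.
have S2 : \sum_k \sum_i nabla_upper_curvature i j k k i = s1.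
  rewrite -S1 exchange_big; apply: eq_bigr => i _; apply: eq_bigr => k _.
  by rewrite nabla_upper_curvatureC.
have S3 : \sum_k \sum_i nabla_upper_curvature j k i k i =
    - (D j (\tr upper_ricci) + 2%:R * \sum_k \sum_p Gam j p k * upper_ricci p k).
  have E1 : \sum_k \sum_i upper_curvature k i k i = - \tr upper_ricci.
    rewrite -sumrN; apply: eq_bigr => k _; rewrite -trace_upper_curvature -sumrN.
    by apply: eq_bigr => i _; rewrite upper_curvatureC oppmxE.
  have E2 : \sum_k \sum_i \sum_p Gam j p k * upper_curvature k i p i =
      - \sum_k \sum_p Gam j p k * upper_ricci p k.
    rewrite -sumrN; apply: eq_bigr => k _; rewrite exchange_big -sumrN.
    apply: eq_bigr => p _; rewrite -trace_upper_curvature -mulr_sumr -mulrN -sumrN.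
    by congr (_ * _); apply: eq_bigr => i _; rewrite upper_curvatureC oppmxE.
  have E3 : \sum_k \sum_i \sum_p upper_curvature k i k p * Gam j p i =
      - \sum_k \sum_p Gam j p k * upper_ricci p k.
    rewrite exchange_big -E2; apply: eq_bigr => i _; apply: eq_bigr => k _.
    by apply: eq_bigr => p _; rewrite mulrC upper_curvatureC oppmxE upper_curvature_anti opprK.
  transitivity (D j (- \tr upper_ricci) - \sum_k \sum_p Gam j p k * upper_ricci p k
                - \sum_k \sum_p Gam j p k * upper_ricci p k); last first.
    by rewrite raddfN; ring.
  rewrite -[in RHS]E1 -{1}E2 -E3 raddf_sum /= -!big_split; apply: eq_bigr => k _ /=.
  rewrite raddf_sum -!big_split; apply: eq_bigr => i _ /=.
  rewrite !addmxE; congr (_ + _ + _); first by rewrite [LHS]mxE.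
    by rewrite [LHS]mxE; apply: eq_bigr => q _; rewrite [in LHS]mxE.
  by rewrite [LHS]mxE.
have : \sum_k \sum_i (nabla_upper_curvature k i j k i + nabla_upper_curvature i j k k i
    + nabla_upper_curvature j k i k i) = 0.
  rewrite big1 // => k _; rewrite big1 // => i _.
  by rewrite -!addmxE second_bianchi mxE.
rewrite (eq_bigr (fun k => \sum_i nabla_upper_curvature k i j k i
     + \sum_i nabla_upper_curvature i j k k i
     + \sum_i nabla_upper_curvature j k i k i)); last by move=> k _; rewrite -!big_split.
rewrite !big_split /= S1 S2 S3 => /eqP; rewrite subr_eq0 => /eqP e.
rewrite -/s1 (_ : D j _ = s1 + s1 - 2%:R * \sum_k \sum_p Gam j p k * upper_ricci p k).
  rewrite -[LHS]mul1r -[X in X * _ = _]half2; ring.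
by rewrite e; ring.
Qed.

(** * Concircular fields and Ricci solitons *)

Section Concircular.
Variables (X : 'rV[A]_m) (al rho lam : A).
Let eta := X *m G.
Hypothesis X_unit : X *m eta^T = (-1)%:M.
Hypothesis nablaX : forall i, nabla i X = al *: ('e_i + eta 0 i *: X).
Hypothesis Dal : forall i, D i al = rho * eta 0 i.

Let dX i : dm i X = al *: ('e_i + eta 0 i *: X) - X *m Gam i.
Proof. by rewrite -nablaX addrK. Qed.

(** As the metric is parallel, its Lie derivative is twice the symmetric part of
nabla X, and al (id + eta (x) X) is already symmetric. *)
Lemma lie_derivative_metric :
  \sum_l X 0 l *: dm l G + (\matrix_(j, l) D j (X 0 l)) *m G
    + ((\matrix_(j, l) D j (X 0 l)) *m G)^T
  = (al + al) *: (G + eta^T *m eta).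
Proof.
(* the symmetry of Gam turns X *m Gam j into row j of \sum_p X_p Gam p *)
have -> : \matrix_(j, l) D j (X 0 l) =
    al *: (1%:M + eta^T *m X) - \sum_p X 0 p *: Gam p.
  apply/matrixP => j l; have /matrixP/(_ 0 l) := dX j.
  rewrite !mxE big_ord1 summxE => ->; rewrite !mxE eqxx andTb (eq_sym l).
  congr (_ * (_ + _ * _) - _); apply: eq_bigr => p _; last by rewrite mxE GamC.
have -> : \sum_l X 0 l *: dm l G =
    (\sum_p X 0 p *: Gam p) *m G + ((\sum_p X 0 p *: Gam p) *m G)^T.
  rewrite mulmx_suml raddf_sum -big_split; apply: eq_bigr => l _ /=.
  by rewrite dG -scalemxAl linearZ /= trmx_mul Gsym -scalerDr.
set N := \sum_p _; rewrite mulmxBl -scalemxAl mulmxDl mul1mx -mulmxA -/eta.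
have : (G + eta^T *m eta)^T = G + eta^T *m eta.
  by rewrite raddfD /= trmx_mul trmxK Gsym.
move: (N *m G) (G + eta^T *m eta) => P S Ss; apply/matrixP => j k.
by rewrite !mxE -[in S k j]Ss [S^T _ _]mxE; ring.
Qed.

Let Geta : eta *m H = X. Proof. by rewrite /eta -mulmxA GH mulmx1. Qed.

Let deta i : dm i eta = al *: (row i G + eta 0 i *: eta) + eta *m (Gam i)^T.
Proof.
rewrite /eta derivation_mulmx dG mulmxDr !mulmxA addrA -mulmxDl dX subrK -/eta.
by rewrite -scalemxAl mulmxDl -scalemxAl -rowE.
Qed.

Let detaE i j : D i (eta 0 j) =
  al * (G i j + eta 0 i * eta 0 j) + \sum_p eta 0 p * Gam i j p.
Proof.
have /matrixP/(_ 0 j) := deta i; rewrite [LHS]mxE => ->.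
rewrite addmxE 2![in LHS]mxE [row i G _ _]mxE [(_ *: eta) _ _]mxE.
by congr (_ + _); rewrite mxE; apply: eq_bigr => p _; rewrite [_^T _ _]mxE.
Qed.

Let detaC i j : D i (eta 0 j) = D j (eta 0 i).
Proof.
have Gs : G i j = G j i by rewrite -[in LHS]Gsym mxE.
rewrite !detaE Gs (mulrC (eta 0 i)); congr (_ + _).
by apply: eq_bigr => p _; rewrite GamC.
Qed.

Let nablaD i p (Y Z : 'M[A]_(p, m)) : nabla i (Y + Z) = nabla i Y + nabla i Z.
Proof. by rewrite /nabla map_mxD mulmxDl addrACA. Qed.

Let nablaZ i p a (Y : 'M[A]_(p, m)) :
  nabla i (a *: Y) = D i a *: Y + a *: nabla i Y.
Proof.
rewrite /nabla -scalemxAl scalerDr addrA; congr (_ + _).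
by apply/matrixP => s t; rewrite !mxE DM.
Qed.

Let nabla_base i j : nabla i ('e_j : 'rV[A]_m) = nabla j 'e_i.
Proof.
have d0 k l : dm k ('e_l : 'rV[A]_m) = 0.
  by apply/matrixP => s t; rewrite !mxE; case: (_ && _); rewrite ?derivation1 ?raddf0.
by apply/matrixP => s t; rewrite /nabla !d0 !add0r -!rowE !mxE GamC.
Qed.

(** The Ricci identity for X: differentiating nabla_j X once more only involves
al, rho, eta and X, and the terms symmetric in i and j drop out. *)
Lemma curvature_xi i j :
  X *m curvature i j = (al * al - rho) *: (eta 0 j *: 'e_i - eta 0 i *: 'e_j).
Proof.
rewrite -ricci_identity !nablaX !(nablaZ, nablaD) !Dal !nablaX (nabla_base j).
rewrite (detaC j).
by apply/matrixP => s t; rewrite !(addmxE, oppmxE, scalemxE); ring.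
Qed.

Let dot_etaX : \sum_k eta 0 k * X 0 k = -1.
Proof.
have /matrixP/(_ 0 0) := X_unit; rewrite !mxE eqxx mulr1n => <-.
by apply: eq_bigr => k _; rewrite mulrC [eta^T _ _]mxE.
Qed.
Hypothesis Dlam : forall i, D i lam = 0.
Hypothesis soliton : ricci_mx = - ((al + lam) *: G + al *: (eta^T *m eta)).

Let ricci_mxE j k : ricci_mx j k = - ((al + lam) * G j k + al * (eta 0 j * eta 0 k)).
Proof. by rewrite soliton !mxE big_ord1 !mxE. Qed.

Let sum_delta (f : 'I_m -> A) j : \sum_k f k * (k == j)%:R = f j.
Proof.
rewrite (bigD1 j) //= eqxx big1 ?mulr1 ?addr0 // => k /negPf kj.
by rewrite kj mulr0.
Qed.

Let eta_cancel a b : (forall j, a * eta 0 j = b * eta 0 j) -> a = b.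
Proof.
move=> ab; suff: a * -1 = b * -1 by rewrite !mulrN1 => /oppr_inj.
rewrite -dot_etaX !mulr_sumr.
by apply: eq_bigr => j _; rewrite !mulrA ab.
Qed.

Let deltaE (i j : 'I_m) : ('e_i : 'rV[A]_m) 0 j = (j == i)%:R.
Proof. by rewrite mxE eqxx. Qed.

(** The form S(., X) is computed twice, as a contraction of [curvature_xi] and
from the soliton equation; both are multiples of eta, which is nonzero. *)
Lemma ricci_xi_xi : (m%:R - 1) * (al * al - rho) = - lam.
Proof.
have E j : (m%:R - 1) * (al * al - rho) * eta 0 j = - lam * eta 0 j.
  have <- : \sum_k X 0 k * ricci_mx j k = - lam * eta 0 j.
    under eq_bigr => k _.
      rewrite ricci_mxE (_ : _ * _ = - (al + lam) * (X 0 k * G k j)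
          - al * eta 0 j * (eta 0 k * X 0 k)); last first.
        by rewrite -[in G j k]Gsym [G^T _ _]mxE; ring.
      over.
    rewrite big_split /= sumrN -!mulr_sumr dot_etaX.
    by rewrite [in RHS]/eta [in RHS]mxE mxE; ring.
  have -> : \sum_k X 0 k * ricci_mx j k = \sum_i (X *m curvature i j) 0 i.
    under eq_bigr do rewrite mxE mulr_sumr.
    by rewrite exchange_big; apply: eq_bigr => i _; rewrite mxE.
  under eq_bigr do rewrite curvature_xi !(scalemxE, addmxE, oppmxE) !deltaE eqxx.
  rewrite -mulr_sumr big_split /= sumrN sumr_const card_ord sum_delta.
  by rewrite mulr1 -mulr_natr; ring.
exact: eta_cancel E.
Qed.

Let upper_ricciE p j : upper_ricci p j = - ((al + lam) * (p == j)%:R + al * (X 0 p * eta 0 j)).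
Proof.
have -> : upper_ricci = - ((al + lam) *: 1%:M + al *: (X^T *m eta)).
  rewrite /upper_ricci soliton raddfN /= mulmxN raddfD /= !linearZ /= trmx_mul trmxK.
  rewrite Gsym mulmxDr -!scalemxAr HG mulmxA; congr (- (_ + _ *: (_ *m _))).
  by rewrite -[H in LHS](inverse_metric_sym Gsym GH) -trmx_mul Geta.
by rewrite !mxE big_ord1 !mxE mulr_natr.
Qed.

(** For S = -(al + lam) G - al eta (x) eta the divergence is
-(m - 1) al^2 eta, since div X = (m - 1) al and X is geodesic; and the trace
r = -m (al + lam) + al satisfies dr = -(m - 1) rho eta. *)
Lemma bianchi_xi j :
  (m%:R - 1) * (rho - (al + al) * al) * eta 0 j = 0.
Proof.
(* Christoffel terms, which cancel in the contracted Bianchi identity *)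
pose T := \sum_k \sum_p Gam k p k * X 0 p.
pose W := \sum_k \sum_p Gam j p k * (X 0 p * eta 0 k).
pose T2 := \sum_k Gam j k k.
have dv : \sum_k D k (X 0 k) = al * (m%:R - 1) - T.
  under eq_bigr => k _.
    have /matrixP/(_ 0 k) := dX k; rewrite [LHS]mxE => ->.
    rewrite !(addmxE, oppmxE, scalemxE) deltaE eqxx; over.
  rewrite big_split /= sumrN -mulr_sumr big_split /= dot_etaX.
  rewrite sumr_const card_ord; congr (_ - _); apply: eq_bigr => k _.
  by rewrite mxE; apply: eq_bigr => p _; rewrite mulrC.
have xdeta : \sum_k X 0 k * D k (eta 0 j) = W.
  under eq_bigr => k _.
    rewrite detaE mulrDr (_ : X 0 k * _ =
      al * (X 0 k * G k j) + al * eta 0 j * (eta 0 k * X 0 k)); last by ring.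
    over.
  rewrite !big_split /= -!mulr_sumr dot_etaX.
  have <- : eta 0 j = \sum_k X 0 k * G k j by rewrite mxE.
  rewrite mulrN1 subrr add0r /W exchange_big; apply: eq_bigr => k _.
  by rewrite mulr_sumr; apply: eq_bigr => p _; rewrite GamC; ring.
have S1 : \sum_k D k (upper_ricci k j) = - (al * (al * (m%:R - 1) - T) * eta 0 j + al * W).
  under eq_bigr => k _.
    have Dn (b : bool) : D k (b%:R : A) = 0 by case: b; [exact: derivation1 | exact: raddf0].
    rewrite upper_ricciE raddfN (raddfD (D k)) /= !DM Dn (raddfD (D k)) Dal Dlam.
    rewrite [X in - X](_ : _ = rho * (eta 0 k * (k == j)%:R)
       + rho * eta 0 j * (eta 0 k * X 0 k) + al * eta 0 j * D k (X 0 k)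
       + al * (X 0 k * D k (eta 0 j))); last by ring.
    over.
  by rewrite sumrN !big_split /= -!mulr_sumr sum_delta dot_etaX dv xdeta; ring.
have S2 : \sum_k \sum_p Gam k p k * upper_ricci p j = - ((al + lam) * T2 + al * eta 0 j * T).
  have F p k : Gam k p k * upper_ricci p j = - ((al + lam) * (Gam k p k * (p == j)%:R)
      + al * eta 0 j * (Gam k p k * X 0 p)) by rewrite upper_ricciE; ring.
  rewrite exchange_big /=.
  under eq_bigr => p _.
    under eq_bigr do rewrite F.
    rewrite sumrN big_split /= -!mulr_sumr -mulr_suml; over.
  rewrite sumrN big_split /= -!mulr_sumr sum_delta; congr (- (_ * _ + _ * _)).
    by apply: eq_bigr => k _; rewrite GamC.
  by rewrite exchange_big.
have S3 : \sum_k \sum_p Gam j p k * upper_ricci p k = - ((al + lam) * T2 + al * W).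
  have F p k : Gam j p k * upper_ricci p k = - ((al + lam) * (Gam j p k * (p == k)%:R)
      + al * (Gam j p k * (X 0 p * eta 0 k))) by rewrite upper_ricciE; ring.
  under eq_bigr => k _.
    under eq_bigr do rewrite F.
    rewrite sumrN big_split /= -!mulr_sumr sum_delta; over.
  by rewrite sumrN big_split /= -!mulr_sumr.
have S4 : D j (\tr upper_ricci) = - ((m%:R - 1) * rho * eta 0 j).
  have -> : \tr upper_ricci = - ((al + lam) *+ m - al).
    rewrite /mxtrace; under eq_bigr => k _.
      rewrite upper_ricciE eqxx mulr1 (mulrC (X 0 k)); over.
    by rewrite sumrN big_split /= -mulr_sumr dot_etaX sumr_const card_ord mulrN1.
  rewrite raddfN (raddfB (D j)) (raddfMn (D j)) (raddfD (D j)) Dlam Dal addr0 -mulr_natr.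
  ring.
have := contracted_bianchi j; rewrite S1 S2 S3 S4 => e.
apply/eqP; rewrite -subr_eq0 subr0 -[X in X == 0]mul1r -[X in X * _ == _]half2; apply/eqP.
have {}e : half * ((m%:R - 1) * rho * eta 0 j) = (m%:R - 1) * al * al * eta 0 j.
  by apply: oppr_inj; rewrite -mulrN -e; ring.
rewrite mulrDl.
transitivity (half * ((m%:R - 1) * rho * eta 0 j) + half * ((m%:R - 1) * rho * eta 0 j)
  - (half + half) * ((m%:R - 1) * (al + al) * al * eta 0 j)); first by ring.
by rewrite half2 e; ring.
Qed.

(** The previous two lemmas make (m - 1) al^2 equal to the constant lam.  So its
derivative 2 (m - 1) al rho eta vanishes, and this is 4 (m - 1) al^3 eta because
(m - 1) rho = 2 (m - 1) al^2. *)
Lemma concircular_soliton : (m%:R - 1) * (al * al * al) *+ 2 = 0.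
Proof.
have E : (m%:R - 1) * (rho - (al + al) * al) = 0.
  by apply: eta_cancel => j; rewrite bianchi_xi mul0r.
have Er : (m%:R - 1) * rho = (m%:R - 1) * (al + al) * al.
  by apply/eqP; rewrite -subr_eq0 -mulrA -mulrBr E.
have El : (m%:R - 1) * (al * al) = lam.
  by apply: oppr_inj; rewrite -ricci_xi_xi mulrBr Er; ring.
have F j : (m%:R - 1) * (al * rho) * eta 0 j = 0.
  apply: double_eq0; have := Dlam j.
  have Dm : D j (m%:R - 1) = 0 by rewrite raddfB raddfMn /= derivation1 mul0rn subrr.
  by rewrite -El !DM Dm Dal => <-; ring.
have {}F : (m%:R - 1) * (al * rho) = 0.
  by apply: eta_cancel => j; rewrite F mul0r.
by rewrite mulrCA Er in F; rewrite -[RHS]F; ring.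
Qed.
End Concircular.

End MetricConnection.
End DifferentialRing.

(** * The Gauss formula for a tangent field *)

Section InducedConnection.
Variables (A : comNzRingType) (m : nat) (D : 'I_m -> {additive A -> A}).
Hypothesis DM : forall i a b, D i (a * b) = D i a * b + a * D i b.
Variable half : A.
Hypothesis half2 : half + half = 1.
Local Notation dm i := (map_mx (D i)).

Section Gauss.
Variables (n : nat) (J : 'M[A]_(m, n)) (g : 'M[A]_n) (dg : 'I_n -> 'M[A]_n).
Hypothesis gsym : g^T = g.
Hypothesis DJ : forall i j p, D i (J j p) = D j (J i p).
Hypothesis Dg : forall i, dm i g = \sum_p J i p *: dg p.

Let addmxE p q (B C : 'M[A]_(p, q)) s t : (B + C) s t = B s t + C s t.
Proof. by rewrite mxE. Qed.

(** The matrix [dg p] stands for the restriction to the submanifold of the p-th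
partial derivative of the ambient metric; the derivations of the ring only
differentiate along the submanifold. *)
Definition ambient_koszul p : 'M[A]_n :=
  \matrix_(q, r) (half * (dg p q r + dg q p r - dg r p q)).

(** The Koszul formula has six terms with second derivatives of the immersion.
These are symmetric in the two directions of differentiation ([DJ]), so four
terms cancel and the other two coincide. *)
Lemma pullback_koszul i :
  koszul D half (J *m g *m J^T) i
  = dm i J *m g *m J^T + \sum_p J i p *: (J *m ambient_koszul p *m J^T).
Proof.
pose P k := dm k J *m g *m J^T.
have PC k j l : P k j l = P j k l.
  rewrite /P -!mulmxA !mxE; apply: eq_bigr => q _.
  by rewrite [(dm k J) _ _]mxE [(dm j J) _ _]mxE DJ.
pose T k j l (c : 'I_n -> 'M[A]_n) := \sum_p J k p * (J *m c p *m J^T) j l.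
have TE k j l c : T k j l c = \sum_p \sum_q \sum_r J k p * J j q * J l r * c p q r.
  apply: eq_bigr => p _; rewrite mxE mulr_sumr [RHS]exchange_big /=.
  apply: eq_bigr => r _; rewrite [(J *m c p) _ _]mxE mulr_suml mulr_sumr.
  by apply: eq_bigr => q _; rewrite [J^T _ _]mxE; ring.
have dGE k j l : D k ((J *m g *m J^T) j l) = P k j l + P k l j + T k j l dg.
  transitivity ((dm k (J *m g *m J^T)) j l); first by rewrite [RHS]mxE.
  rewrite !(derivation_mulmx DM) mulmxDl addrAC !addmxE; congr (_ + _ + _).
    transitivity ((P k)^T j l); last by rewrite mxE.
    by rewrite /P !trmx_mul trmxK gsym mulmxA map_trmx.
  rewrite Dg mulmx_sumr mulmx_suml summxE; apply: eq_bigr => p _.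
  by rewrite -scalemxAr -scalemxAl mxE.
have T1 j l : T j i l dg = T i j l (fun p => \matrix_(q, r) dg q p r).
  rewrite !TE exchange_big; apply: eq_bigr => p _; apply: eq_bigr => q _.
  by apply: eq_bigr => r _; rewrite mxE; ring.
have T2 j l : T l i j dg = T i j l (fun p => \matrix_(q, r) dg r p q).
  rewrite !TE exchange_big; apply: eq_bigr => p _; rewrite exchange_big.
  apply: eq_bigr => q _; apply: eq_bigr => r _; rewrite mxE; ring.
have T3 j l : (\sum_p J i p *: (J *m ambient_koszul p *m J^T)) j l = 
    half * (T i j l dg + T j i l dg - T l i j dg).
  transitivity (T i j l ambient_koszul).
    by rewrite summxE; apply: eq_bigr => p _; rewrite mxE.
  rewrite T1 T2 !TE -big_split -sumrB mulr_sumr; apply: eq_bigr => p _ /=.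
  rewrite -big_split -sumrB mulr_sumr; apply: eq_bigr => q _ /=.
  rewrite -big_split -sumrB mulr_sumr; apply: eq_bigr => r _ /=.
  by rewrite !mxE; ring.
apply/matrixP => j l; rewrite [RHS]mxE T3 mxE !dGE -/(P i).
rewrite (PC j i) (PC l i) (PC l j) -[P i j l in RHS]mul1r -half2; ring.
Qed.

Variables (xi : 'rV[A]_n) (dxi : 'I_n -> 'rV[A]_n) (al : A).
Hypothesis Dxi : forall i, dm i xi = \sum_p J i p *: dxi p.
Let etat := xi *m g.
Hypothesis amb : forall p,
  dxi p *m g + xi *m ambient_koszul p = al *: (row p g + etat 0 p *: etat).
Variables (X : 'rV[A]_m) (H : 'M[A]_m).
Hypothesis XJ : X *m J = xi.
Hypothesis GH : J *m g *m J^T *m H = 1%:M.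

(** The two covariant derivatives are compared through their scalar products
with tangent vectors, which determine the induced one.  The second derivatives
of the immersion in [pullback_koszul] are those in the derivative of
xi = X *m J. *)
Lemma induced_nabla_xi i :
  let G := J *m g *m J^T in
  nabla D (levi_civita D half G H) i X = al *: ('e_i + (X *m G) 0 i *: X).
Proof.
move=> G; have HG : H *m G = 1%:M by exact: mulmx1C.
have GE : X *m G = etat *m J^T by rewrite !mulmxA XJ.
suff E : nabla D (levi_civita D half G H) i X *m G =
    al *: (row i G + (X *m G) 0 i *: (X *m G)).
  rewrite -[LHS]mulmx1 -GH mulmxA E -scalemxAl mulmxDl -scalemxAl -mulmxA GH.
  by rewrite mulmx1 -row_mul GH row1.
rewrite /nabla mulmxDl -mulmxA levi_civitaG // pullback_koszul mulmxDr addrA.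
have -> : dm i X *m G + X *m (dm i J *m g *m J^T) = dm i xi *m g *m J^T.
  by rewrite /G -XJ derivation_mulmx // !mulmxDl !mulmxA.
have -> : X *m (\sum_p J i p *: (J *m ambient_koszul p *m J^T)) =
    \sum_p J i p *: (xi *m ambient_koszul p *m J^T).
  rewrite mulmx_sumr; apply: eq_bigr => p _.
  by rewrite -scalemxAr !mulmxA XJ.
rewrite Dxi !mulmx_suml -big_split /=.
under eq_bigr => p _.
  rewrite -!scalemxAl -scalerDr -mulmxDl amb -scalemxAl scalerA mulrC -scalerA.
  rewrite mulmxDl -scalemxAl -GE scalerDr scalerA; over.
rewrite -scaler_sumr big_split /= -scaler_suml; congr (_ *: (_ + _ *: _)).
  rewrite /G !row_mul (mulmx_sum_row (row i J)) mulmx_suml; apply: eq_bigr => p _.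
  by rewrite -scalemxAl mxE.
by rewrite GE mxE; apply: eq_bigr => p _; rewrite mulrC [J^T _ _]mxE.
Qed.
End Gauss.
End InducedConnection.

(** * Restriction of ambient functions to the submanifold *)

Section Pullback.
Variables (R : realType) (m n : nat) (S : pointed_open R m).
Variables (F : 'rV[R]_m -> 'rV[R]_n) (W : set 'rV[R]_n).
Hypothesis oW : open W.
Hypothesis sF : smooth_on (po_set S) F.
Hypothesis FW : forall u, po_set S u -> W (F u).

Lemma pullback_smooth (f : 'rV[R]_n -> R) :
  smooth_on W f -> smooth_on (po_set S) (f \o F).
Proof. by move=> sf; apply: (smooth_exprW (po_open S)); exact: (@se_comp _ _ _ _ W). Qed.

Definition pullback f (sf : smooth_on W f) : smoothring S :=
  to_smoothring (pullback_smooth sf).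

Lemma ev_pullback f (sf : smooth_on W f) u : po_set S u -> ev u (pullback sf) = f (F u).
Proof. exact: to_smoothringE. Qed.

Definition jacobian_smoothring : 'M[smoothring S]_(m, n) :=
  \matrix_(j, k) partial j (to_smoothring (smooth_on_coord 0 k (po_open S) sF)).

Lemma ev_jacobian u : po_set S u -> map_mx (ev u) jacobian_smoothring = 'J F u.
Proof.
move=> Su; apply/matrixP => j k; rewrite mxE [jacobian_smoothring _ _]mxE /ev partialE//.
have dF := smooth_differentiable sF Su.
transitivity (('D_('e_j) F u) 0 k); last first.
  by rewrite deriveEjacobian// -rowE mxE.
rewrite -derive_coord; last exact: diff_derivable.
by apply/near_eq_derive/(open_near_eq (po_open S) Su) => w Sw; rewrite to_smoothringE.
Qed.

Lemma jacobian_smoothringC j k p :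
  partial j (jacobian_smoothring k p) = partial k (jacobian_smoothring j p).
Proof. by rewrite !mxE partialC. Qed.

Lemma ev_inj (f g : smoothring S) : (forall u, po_set S u -> ev u f = ev u g) -> f = g.
Proof. exact: smoothring_ext. Qed.

Lemma ev_mx_inj p q (A B : 'M[smoothring S]_(p, q)) :
  (forall u, po_set S u -> map_mx (ev u) A = map_mx (ev u) B) -> A = B.
Proof.
move=> AB; apply/matrixP => j k; apply: ev_inj => u Su.
by have /matrixP/(_ j k) := AB u Su; rewrite !mxE.
Qed.

Lemma partial_pullback f (sf : smooth_on W f) j :
  partial j (pullback sf) = \sum_k jacobian_smoothring j k * pullback (smooth_partial k sf).
Proof.
apply: ev_inj => u Su; rewrite rmorph_sum /= ev_partial//.
transitivity ('D_('e_j) (f \o F) u).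
  by apply/near_eq_derive/(open_near_eq (po_open S) Su) => w Sw; exact: to_smoothringE.
have dF := smooth_differentiable sF Su.
rewrite derive_comp//; last exact: smooth_differentiable sf (FW Su).
apply: eq_bigr => k _; rewrite rmorphM /= ev_pullback// deriveEjacobian// -rowE.
by rewrite -ev_jacobian// !mxE.
Qed.

Definition pullback_mx p q (f : 'rV[R]_n -> 'M[R]_(p, q)) (sf : smooth_on W f) :
  'M[smoothring S]_(p, q) := \matrix_(j, k) pullback (smooth_on_coord j k oW sf).

Lemma ev_pullback_mx p q f (sf : smooth_on W f) u : po_set S u ->
  map_mx (ev u) (@pullback_mx p q f sf) = f (F u).
Proof. by move=> Su; apply/matrixP => j k; rewrite !mxE ev_pullback. Qed.

Lemma partial_pullback_mx p q f (sf : smooth_on W f) j :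
  map_mx (partial j) (@pullback_mx p q f sf) =
  \sum_k jacobian_smoothring j k *: pullback_mx (smooth_partial k sf).
Proof.
apply/matrixP => s t; rewrite summxE !mxE partial_pullback; apply: eq_bigr => k _.
rewrite !mxE; congr (_ * _); apply: ev_inj => u Su; rewrite !ev_pullback//.
apply: derive_coord; apply: diff_derivable.
exact: smooth_differentiable sf (FW Su).
Qed.
End Pullback.

Section RingDerivative.
Variables (R : realType) (m : nat) (S : pointed_open R m).
Let U := po_set S.
Let oU : open U := po_open S.

Lemma derivable_smoothring p q (f : 'rV[R]_m -> 'M[R]_(p, q))
    (B : 'M[smoothring S]_(p, q)) u v :
  (forall w, U w -> f w = map_mx (ev w) B) -> U u -> derivable f u v.
Proof.
move=> fB Uu; apply/derivable_mxP => j k.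
apply: (@near_eq_derivable _ _ _ (B j k : _ -> R)).
  by apply: (open_near_eq oU Uu) => w Uw; rewrite fB// mxE.
exact: diff_derivable (smooth_differentiable (smoothring_smooth (B j k)) Uu).
Qed.

Lemma derive_smoothring p q (f : 'rV[R]_m -> 'M[R]_(p, q))
    (B : 'M[smoothring S]_(p, q)) u v :
  (forall w, U w -> f w = map_mx (ev w) B) -> U u ->
  'D_v f u = \sum_l v 0 l *: map_mx (ev u) (map_mx (partial l) B).
Proof.
move=> fB Uu; apply/matrixP => j k; rewrite summxE.
rewrite -derive_coord; last exact: derivable_smoothring fB Uu.
have dB := smooth_differentiable (smoothring_smooth (B j k)) Uu.
transitivity ('D_v (B j k : _ -> R) u).
  by apply/near_eq_derive/(open_near_eq oU Uu) => w Uw; rewrite fB// mxE.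
rewrite (derive_sum_base _ dB); apply: eq_bigr => l _.
by rewrite !mxE; congr (_ * _); rewrite -partialE.
Qed.
End RingDerivative.

(** * Independence of the ambient chart *)

Lemma row_jacobian (R : realType) m n (f : 'rV[R]_m -> 'rV[R]_n) u j :
  differentiable f u -> row j ('J f u) = 'D_('e_j) f u.
Proof. by move=> df; rewrite (deriveEjacobian _ df) rowE. Qed.

Lemma jacobian_near_eq (R : realType) m n (f g : 'rV[R]_m -> 'rV[R]_n) u :
  {near u, f =1 g} -> differentiable f u -> 'J f u = 'J g u.
Proof.
move=> fg df; have dg := near_eq_differentiable fg df.
apply/row_matrixP => j.
apply: etrans (row_jacobian j df) _.
apply: etrans (esym (row_jacobian j dg)).
exact: near_eq_derive fg.
Qed.

Lemma jacobian_comp (R : realType) m n k (f : 'rV[R]_m -> 'rV[R]_n)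
    (g : 'rV[R]_n -> 'rV[R]_k) u :
  differentiable f u -> differentiable g (f u) ->
  'J (g \o f) u = 'J f u *m 'J g (f u).
Proof.
move=> df dg; apply/row_matrixP => j; have dgf := differentiable_comp df dg.
rewrite row_mul (row_jacobian _ df) (row_jacobian _ dgf) -(deriveEjacobian _ dg).
by rewrite (deriveE _ dgf) (deriveE _ df) (deriveE _ dg) (diff_comp df dg).
Qed.

Section Overlap.
Variables (R : realType) (m n : nat) (N : manifold R n) (M : manifold R m) (i : M -> N).
Hypothesis hM : submanifold i.
Variables (a : atlas M).

Definition overlap (b : atlas N) : set 'rV[R]_m :=
  [set u | img a u /\ dom b (i (param a u))].

Lemma overlap_open b : open (overlap b).
Proof.
rewrite openE => u [au bu]; apply: filterI.
  exact: open_nbhs_nbhs (conj (@img_open _ _ M a) au).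
have [[ci _] _ _] := hM.
have cp : {for u, continuous (param a)} := param_continuous au.
have nb : nbhs (i (param a u)) (dom b) := open_nbhs_nbhs (conj (@dom_open _ _ N b) bu).
exact: (cp _ (ci _ _ nb)).
Qed.

Lemma overlap_img b u : overlap b u -> img b (locrep i a b u).
Proof. by move=> [_ bu]; exists (i (param a u)). Qed.

Lemma overlap_param b u : overlap b u -> param b (locrep i a b u) = i (param a u).
Proof. by move=> [_ bu]; exact: coordK. Qed.

Lemma overlap_smooth b : smooth_on (overlap b) (locrep i a b).
Proof. by have [[_ si] _ _] := hM; exact: si. Qed.

Lemma overlap_free b u : overlap b u -> row_free ('J (locrep i a b) u).
Proof. by move=> [au bu]; have [_ _] := hM; exact. Qed.

Lemma locrep_change b b' u : overlap b u -> overlap b' u ->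
  locrep id b b' (locrep i a b u) = locrep i a b' u.
Proof. by move=> Ub _; rewrite /locrep /= -/(locrep i a b u) overlap_param. Qed.

Lemma jacobian_change b b' u : overlap b u -> overlap b' u ->
  'J (locrep i a b') u = 'J (locrep i a b) u *m 'J (locrep id b b') (locrep i a b u).
Proof.
move=> Ub Ub'.
have dF := smooth_differentiable (@overlap_smooth b) Ub.
have dT : differentiable (locrep id b b') (locrep i a b u).
  apply: (smooth_differentiable (@transition_smooth _ _ N b b')).
  split; first exact: overlap_img.
  by rewrite overlap_param//; case: Ub'.
rewrite -(jacobian_comp dF dT); apply: jacobian_near_eq.
  apply: (@open_near_eq _ _ _ (overlap b `&` overlap b')) => //.
    by apply: openI; exact: overlap_open.
  by move=> w [Wb Wb'] /=; rewrite locrep_change.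
exact: smooth_differentiable (@overlap_smooth b') Ub'.
Qed.

Lemma overlap_chart_at u : img a u -> overlap (chart_at N (i (param a u))) u.
Proof. by split => //; exact: chart_atP. Qed.

Variables (g : lorentzian_metric N) (xi : vector_field N).

(** The ambient chart in the definition of the induced metric varies with the
point; derivatives need an expression in a fixed chart near the point.  The
same holds for the restricted field below. *)
Lemma induced_metricE b u : overlap b u ->
  induced_metric g i a u =
  'J (locrep i a b) u *m g b (locrep i a b u) *m ('J (locrep i a b) u)^T.
Proof.
move=> Ub; have Ub' := overlap_chart_at (proj1 Ub).
rewrite /induced_metric; set b' := chart_at _ _ in Ub' *.
rewrite (jacobian_change Ub Ub') -(locrep_change Ub Ub').
rewrite (@metric_compat _ _ _ g b b' (locrep i a b u)); first last.
- by rewrite overlap_param//; case: Ub'.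
- exact: overlap_img.
by rewrite trmx_mul !mulmxA.
Qed.

Lemma restricted_xiE b u : overlap b u ->
  (xi b (locrep i a b u) <= 'J (locrep i a b) u)%MS ->
  restricted_xi xi i a u *m 'J (locrep i a b) u = xi b (locrep i a b u).
Proof.
move=> Ub /submxP[x xJ]; have Ub' := overlap_chart_at (proj1 Ub).
rewrite /restricted_xi; set b' := chart_at _ _ in Ub' *.
rewrite -(locrep_change Ub Ub') (@vf_compat _ _ _ xi b b'); first last.
- by rewrite overlap_param//; case: Ub'.
- exact: overlap_img.
rewrite xJ -(mulmxA x) -(jacobian_change Ub Ub') -(mulmxA x) mulmxVp ?mulmx1//.
exact: overlap_free.
Qed.
End Overlap.

(** * Coordinate tensors as matrices over the ring *)

Section MatrixDerivative.
Variables (R : realType) (V : normedModType R).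

Lemma is_derive_mx p q (f : V -> 'M[R]_(p, q)) (df : 'M[R]_(p, q)) u v :
  (forall j k, is_derive u v (fun w => f w j k) (df j k)) -> is_derive u v f df.
Proof.
move=> h; have df' : derivable f u v by apply/derivable_mxP => j k; case: (h j k).
apply: DeriveDef => //; rewrite derive_mx//; apply/matrixP => j k.
by rewrite mxE; case: (h j k).
Qed.

Lemma is_derive_mulmx p q r (f : V -> 'M[R]_(p, q)) (g : V -> 'M[R]_(q, r)) u v :
  derivable f u v -> derivable g u v ->
  is_derive u v (fun w => f w *m g w) ('D_v f u *m g u + f u *m 'D_v g u).
Proof.
move=> df dg; apply: is_derive_mx => j k.
pose h l w := f w j l * g w l k.
have -> : (fun w => (f w *m g w) j k) = \sum_l h l.
  by apply/funext => w; rewrite fct_sumE mxE.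
have -> : ('D_v f u *m g u + f u *m 'D_v g u) j k =
    \sum_l (f u j l *: 'D_v (fun w => g w l k) u + g u l k *: 'D_v (fun w => f w j l) u).
  rewrite !mxE -big_split; apply: eq_bigr => l _ /=.
  by rewrite !derive_coord// addrC; congr (_ + _); rewrite mulrC.
apply: is_derive_sum => l.
have /derivable_mxP/(_ j l)/derivableP df' := df.
have /derivable_mxP/(_ l k)/derivableP dg' := dg.
exact: is_deriveM.
Qed.

Lemma is_derive_trmx p q (f : V -> 'M[R]_(p, q)) u v :
  derivable f u v -> is_derive u v (fun w => (f w)^T) ('D_v f u)^T.
Proof.
move=> df; apply: is_derive_mx => j k; rewrite mxE -derive_coord//.
under eq_fun do rewrite mxE; apply: derivableP.
by move/derivable_mxP: df.
Qed.

Lemma derive_gdot n (G : V -> 'M[R]_n) (Y Z : V -> 'rV[R]_n) u v :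
  derivable G u v -> derivable Y u v -> derivable Z u v ->
  'D_v (fun w => gdot (G w) (Y w) (Z w)) u =
  gdot ('D_v G u) (Y u) (Z u) + gdot (G u) ('D_v Y u) (Z u)
  + gdot (G u) (Y u) ('D_v Z u).
Proof.
move=> dG dY dZ; have dYG := is_derive_mulmx dY dG.
have dZt := is_derive_trmx dZ.
have d := is_derive_mulmx (@ex_derive _ _ _ _ _ _ _ dYG) (@ex_derive _ _ _ _ _ _ _ dZt).
rewrite /gdot derive_coord; last exact: (@ex_derive _ _ _ _ _ _ _ d).
rewrite (@derive_val _ _ _ _ _ _ _ d) (@derive_val _ _ _ _ _ _ _ dYG).
rewrite (@derive_val _ _ _ _ _ _ _ dZt) mulmxDl 2!mxE.
by rewrite [X in X + _ = _]addrC.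
Qed.
End MatrixDerivative.

Section Christoffel.
Variables (R : realType) (n : nat).

Lemma christoffel_lower (G : 'rV[R]_n -> 'M[R]_n) u x y : G u \in unitmx ->
  christoffel G u x y *m G u =
  \row_l (2^-1 * (gdot ('D_x G u) y 'e_l + gdot ('D_y G u) x 'e_l
                   - gdot ('D_('e_l) G u) x y)).
Proof. by move=> uG; rewrite /christoffel mulmxKV. Qed.

Lemma gdot_baser (G : 'M[R]_n) x l : gdot G x 'e_l = \sum_j x 0 j * G j l.
Proof. by rewrite /gdot trmx_delta -colE !mxE. Qed.

Lemma gdot_basel (G : 'M[R]_n) x l : gdot G 'e_l x = \sum_j x 0 j * G l j.
Proof.
by rewrite /gdot -rowE mxE; apply: eq_bigr => j _; rewrite !mxE mulrC.
Qed.
End Christoffel.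

Section RingMetric.
Variables (R : realType) (m : nat) (S : pointed_open R m).
Let U := po_set S.
Let oU : open U := po_open S.
Let A := smoothring S.
Variables (half : A) (G H : 'M[A]_m) (g : 'rV[R]_m -> 'M[R]_m).
Hypothesis half2 : half + half = 1.
Hypothesis Gsym : G^T = G.
Hypothesis GH : G *m H = 1%:M.
Hypothesis gE : forall u, U u -> g u = map_mx (ev u) G.
Local Notation Gam := (levi_civita (@partial R m S) half G H).
Local Notation nabla := (nabla (@partial R m S) Gam).
Local Notation "B ^@ u" := (map_mx (ev u) B) (at level 2).

Lemma ev_half u : ev u half = 2^-1.
Proof.
have := congr1 (ev u) half2; rewrite rmorphD rmorph1 /= => h.
by apply: (mulIf (_ : 2 != 0 :> R)); rewrite ?pnatr_eq0// mulVf ?pnatr_eq0// mulr_natr.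
Qed.

Lemma metric_unit u : U u -> g u \in unitmx /\ invmx (g u) = H^@u.
Proof.
move=> Uu; have E : g u *m H^@u = 1%:M by rewrite gE// -map_mxM GH map_mx1.
have [uG uH] := mulmx1_unit E; split => //.
by rewrite -[RHS]mul1mx -(mulVmx uG) -mulmxA E mulmx1.
Qed.

Lemma derive_metric u v : U u ->
  'D_v g u = \sum_l v 0 l *: (map_mx (partial l) G)^@u.
Proof. exact: derive_smoothring gE. Qed.

Lemma derive_metric_base u k : U u -> 'D_('e_k) g u = (map_mx (partial k) G)^@u.
Proof.
move=> Uu; rewrite derive_metric// (bigD1 k)//= mxE !eqxx scale1r big1 ?addr0// => l lk.
by rewrite mxE (negPf lk) andbF scale0r.
Qed.

Lemma christoffel_smoothring u k y : U u ->
  christoffel g u 'e_k y = y *m (Gam k)^@u.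
Proof.
move=> Uu; have [uG iG] := metric_unit Uu.
rewrite /christoffel iG map_mxM mulmxA; congr (_ *m _).
apply/rowP => l; rewrite !mxE (derive_metric_base k Uu) (derive_metric_base l Uu).
rewrite (derive_metric y Uu).
rewrite gdot_baser gdot_base summxE gdot_basel -big_split -sumrB mulr_sumr.
apply: eq_bigr => j _ /=; rewrite !mxE rmorphM rmorphB rmorphD /= ev_half; ring.
Qed.

Lemma cov_smoothring u k (f : 'rV[R]_m -> 'rV[R]_m) (Y : 'rV[A]_m) :
  U u -> (forall w, U w -> f w = Y^@w) -> cov g 'e_k f u = (nabla k Y)^@u.
Proof.
move=> Uu fY; rewrite /cov christoffel_smoothring// fY// (derive_smoothring _ fY)//.
rewrite /nabla map_mxD; congr (_ + _); last by rewrite [RHS]map_mxM.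
rewrite (bigD1 k)//= mxE !eqxx scale1r big1 ?addr0// => l lk.
by rewrite mxE (negPf lk) andbF scale0r.
Qed.

Lemma ricci_smoothring u j k : U u ->
  ricci g (fun=> 'e_j) (fun=> 'e_k) u = ev u (ricci_mx (@partial R m S) Gam j k).
Proof.
move=> Uu; rewrite [ricci_mx _ _ _ _]mxE rmorph_sum; apply: eq_bigr => l _ /=.
have e1 p w : 'e_p = ('e_p : 'rV[A]_m)^@w by rewrite map_delta_mx.
have e2 p q w : U w -> cov g 'e_p (fun=> 'e_q) w = (nabla p ('e_q : 'rV[A]_m))^@w.
  by move=> Uw; apply: cov_smoothring.
rewrite /riemann (cov_smoothring _ Uu (e2 j k)) (cov_smoothring _ Uu (e2 l k)).
have -> : lie_bracket (fun=> 'e_l) (fun=> 'e_j) u = 0 :> 'rV[R]_m.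
  by rewrite /lie_bracket !derive_cst subrr.
have -> : cov g 0 (fun=> 'e_k) u = 0.
  rewrite /cov derive0 add0r /christoffel derive0.
  rewrite (_ : \row_l _ = 0) ?mul0mx//; apply/rowP => p; rewrite !mxE.
  by rewrite /gdot !(mulmx0, mul0mx) !mxE addr0 subrr mulr0.
rewrite subr0 -map_mxB (ricci_identity (@partialM R m S) (@partialC R m S)).
by rewrite -rowE !mxE.
Qed.

Lemma lie_metric_smoothring (V : 'rV[R]_m -> 'rV[R]_m) (X : 'rV[A]_m) Y Z u :
  U u -> (forall w, U w -> V w = X^@w) ->
  differentiable Y u -> differentiable Z u ->
  lie_metric V g Y Z u = gdot (map_mx (ev u)
    (\sum_l X 0 l *: map_mx (partial l) G
     + (\matrix_(j, l) partial j (X 0 l)) *m G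
     + ((\matrix_(j, l) partial j (X 0 l)) *m G)^T)) (Y u) (Z u).
Proof.
move=> Uu VX dY dZ.
have dg v : derivable g u v by exact: derivable_smoothring gE Uu.
have dVE v : 'D_v V u = v *m (\matrix_(j, l) partial j (X 0 l))^@u.
  rewrite (derive_smoothring v VX Uu) mulmx_sum_row; apply: eq_bigr => l _.
  by congr (_ *: _); apply/rowP => p; rewrite !mxE.
have Lprod : 'D_(V u) (fun w => gdot (g w) (Y w) (Z w)) u =
  gdot ('D_(V u) g u) (Y u) (Z u) + gdot (g u) ('D_(V u) Y u) (Z u)
  + gdot (g u) (Y u) ('D_(V u) Z u).
  rewrite (derive_gdot (dg _)); [by []|exact: diff_derivable..].
rewrite /lie_metric Lprod /lie_bracket !dVE (derive_metric _ Uu) VX//.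
set L := \sum_l _ ; have -> : L = (\sum_l X 0 l *: map_mx (partial l) G)^@u.
  apply/matrixP => p q; rewrite !(mxE, summxE) rmorph_sum; apply: eq_bigr => l _ /=.
  by rewrite !mxE rmorphM.
rewrite !map_mxD -map_trmx map_mxM -gE//.
set P := (\matrix_(j, l) _)^@u.
have gs : (g u)^T = g u by rewrite gE// map_trmx Gsym.
have e1 : gdot (g u) (Y u *m P) (Z u) = gdot (P *m g u) (Y u) (Z u).
  by rewrite /gdot !mulmxA.
have e2 : gdot (g u) (Y u) (Z u *m P) = gdot (P *m g u)^T (Y u) (Z u).
  by rewrite /gdot !trmx_mul gs !mulmxA.
rewrite gdotBl gdotBr e1 e2 !gdot_mxD; ring.
Qed.
End RingMetric.

(** * Concircular fields in a chart *)

Section ConcircularChart.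
Variables (R : realType) (m : nat) (S : pointed_open R m).
Let U := po_set S.
Let A := smoothring S.
Local Notation "B ^@ u" := (map_mx (ev u) B) (at level 2).

(** What the ambient structure induces on M near a point, written in the ring of
smooth functions.  The pointwise data g, V and alpha are only prescribed on the
open set. *)
Variant concircular_chart (g : 'rV[R]_m -> 'M[R]_m) (V : 'rV[R]_m -> 'rV[R]_m)
    (alpha : 'rV[R]_m -> R) : Prop :=
  ConcircularChart (half : A) (G H : 'M[A]_m) (X : 'rV[A]_m) (al rho : A) of
    half + half = 1 & G^T = G & G *m H = 1%:M &
    (forall u, U u -> g u = G^@u) & (forall u, U u -> V u = X^@u) &
    (forall u, U u -> alpha u = ev u al) &
    X *m (X *m G)^T = (-1)%:M &
    (forall j, nabla (@partial R m S) (levi_civita (@partial R m S) half G H) j X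
               = al *: ('e_j + (X *m G) 0 j *: X)) &
    (forall j, partial j al = rho * (X *m G) 0 j).

Variables (g : 'rV[R]_m -> 'M[R]_m) (V : 'rV[R]_m -> 'rV[R]_m).
Variable alpha : 'rV[R]_m -> R.
Hypothesis chart : concircular_chart g V alpha.

Lemma concircular_lie_metric Y Z u : U u -> differentiable Y u -> differentiable Z u ->
  lie_metric V g Y Z u = 2 * alpha u *
    (gdot (g u) (Y u) (Z u) + gdot (g u) (Y u) (V u) * gdot (g u) (Z u) (V u)).
Proof.
case: chart => half G H X al rho h2 Gs GH gG VX aE X1 nX Dal Uu dY dZ.
rewrite (lie_metric_smoothring Gs gG Uu VX dY dZ).
have GamC := @levi_civitaC _ _ (@partial R m S) half _ H Gs.
have dG := @levi_civita_metric _ _ (@partial R m S) _ h2 _ _ Gs GH.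
rewrite (lie_derivative_metric Gs GamC dG nX).
rewrite map_mxZ rmorphD /= -aE// map_mxD -gG// gdot_mxZ gdot_mxD.
rewrite map_mxM -map_trmx map_mxM -VX// -gG//.
have gs : (g u)^T = g u by rewrite gG// map_trmx Gs.
congr (_ * (_ + _)); first by rewrite mulr2n mulrDl mul1r.
by rewrite gdot_dyad trmx_mul gs /gdot !mulmxA.
Qed.

(** The value at u of [concircular_soliton] is 2 (m - 1) alpha(u)^3 = 0. *)
Lemma concircular_soliton_dim lambda u : U u -> alpha u != 0 ->
  (forall j k, forall w, U w -> lie_metric V g (fun=> 'e_j) (fun=> 'e_k) w
     + 2 * ricci g (fun=> 'e_j) (fun=> 'e_k) w + 2 * lambda * gdot (g w) 'e_j 'e_k = 0) ->
  m = 1%N.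
Proof.
move=> Uu au0 sol.
case: chart => half G H X al rho h2 Gs GH gG VX aE X1 nX Dal.
have GamC := @levi_civitaC _ _ (@partial R m S) half _ H Gs.
have dG := @levi_civita_metric _ _ (@partial R m S) _ h2 _ _ Gs GH.
pose lam : A := to_smoothring (@smooth_on_cst R m _ U lambda).
have lamE w : U w -> ev w lam = lambda by move=> Uw; exact: to_smoothringE.
have Dlam j : partial j lam = 0.
  apply: ev_inj => w Uw; rewrite ev_partial// rmorph0.
  rewrite -[RHS](derive_cst lambda w 'e_j).
  by apply/near_eq_derive/(open_near_eq (po_open S) Uw) => z Uz; exact: (lamE z Uz).
have ricci_mxE : ricci_mx (@partial R m S) (levi_civita (@partial R m S) half G H) =
    - ((al + lam) *: G + al *: ((X *m G)^T *m (X *m G))).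
  apply/matrixP => j k; apply: ev_inj => w Uw.
  have := sol j k w Uw; rewrite (ricci_smoothring h2 GH gG)// gdot_base.
  have dcst l : differentiable (fun=> 'e_l : 'rV[R]_m) w := differentiable_cst _ _.
  rewrite (lie_metric_smoothring Gs gG Uw VX (dcst j) (dcst k)).
  rewrite (lie_derivative_metric Gs GamC dG nX) gdot_base gG// !mxE.
  rewrite !(rmorphN, rmorphM, rmorphD) /= lamE// => E.
  apply: (mulfI (_ : 2 != 0 :> R)); rewrite ?pnatr_eq0//.
  apply/eqP; rewrite -subr_eq0 -E; apply/eqP; ring.
have := concircular_soliton (@partialM R m S) (@partialC R m S) h2 Gs GH GamC dG X1
  nX Dal Dlam ricci_mxE.
move=> /(congr1 (ev u)); rewrite rmorph0 rmorphMn !rmorphM rmorphB rmorph_nat rmorph1 /= -aE//.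
move=> /eqP; rewrite mulrn_eq0 /= !mulf_eq0 (negPf au0) !orbF subr_eq0.
by rewrite (eqr_nat R m 1) => /eqP.
Qed.
End ConcircularChart.

(** * Invariant submanifolds *)

Lemma christoffel_mulmx (R : realType) n (G : 'rV[R]_n -> 'M[R]_n) u x :
  differentiable G u -> exists K, forall y, christoffel G u x y = y *m K.
Proof.
move=> dG; pose K := \matrix_(j, l) (2^-1 * (('D_x G u) j l
  + (x *m 'D_('e_j) G u) 0 l - (x *m 'D_('e_l) G u) 0 j)).
exists (K *m invmx (G u)) => y; rewrite /christoffel mulmxA; congr (_ *m _).
have gdotEr A z : gdot A x z = \sum_j z 0 j * (x *m A) 0 j.
  by rewrite /gdot mxE; apply: eq_bigr => j _; rewrite mulrC [z^T _ _]mxE.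
apply/rowP => l; rewrite !mxE (derive_sum_base y dG) gdot_baser (gdotEr _ y).
rewrite (_ : gdot (\sum_k _) x 'e_l = \sum_j y 0 j * (x *m 'D_('e_j) G u) 0 l); last first.
  rewrite /gdot mulmx_sumr mulmx_suml summxE; apply: eq_bigr => j _.
  by rewrite -scalemxAr -scalemxAl trmx_delta -colE !mxE.
rewrite -big_split -sumrB mulr_sumr; apply: eq_bigr => j _ /=.
rewrite [K _ _]mxE; ring.
Qed.

Section Submanifold.
Variables (R : realType) (n m : nat) (N : manifold R n) (g : lorentzian_metric N)
  (xi : vector_field N) (alpha : N -> R) (hN : is_LCS g xi alpha)
  (M : manifold R m) (i : M -> N) (hM : submanifold i)
  (hinv : invariant_submanifold g xi i).
Variables (a : atlas M) (b : atlas N) (u0 : 'rV[R]_m) (U0 : overlap i a b u0).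

Definition overlap_pointed := PointedOpen (@overlap_open _ _ _ N M i hM a b) U0.
Local Notation S := overlap_pointed.
Local Notation U := (overlap i a b).
Local Notation F := (locrep i a b).
Local Notation A := (smoothring S).
Local Notation "B ^@ u" := (map_mx (ev u) B) (at level 2).

Let oW : open (img b) := @img_open _ _ N b.
Let sF : smooth_on (po_set S) F := overlap_smooth hM (a := a) (b := b).
Let FW u : po_set S u -> img b (F u) := @overlap_img _ _ _ _ _ i a b u.

Let xiJ u : U u -> (xi b (F u) <= 'J F u)%MS.
Proof. by case=> au bu; have [] := hinv au bu. Qed.

Let Vxi u : U u -> restricted_xi xi i a u *m 'J F u = xi b (F u).
Proof. by move=> Uu; rewrite restricted_xiE//; exact: xiJ. Qed.

Let xi_neg u : U u -> gdot (g b (F u)) (xi b (F u)) (xi b (F u)) < 0.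
Proof. by move=> Uu; rewrite (lcs_unit hN (FW Uu)) ltrN10. Qed.

Let gl u : U u -> lorentzian_form (g b (F u)).
Proof. by move=> Uu; exact: metric_lorentzian (FW Uu). Qed.

(** The ambient equations are pulled back to M, lowered with the metric, and
handed to [induced_nabla_xi].  Tangency of xi enters twice: it provides the
components X of xi in the chart of M, and, xi being timelike, it makes the
induced metric invertible. *)
Lemma overlap_concircular :
  concircular_chart S (induced_metric g i a) (restricted_xi xi i a)
    (fun u => alpha (i (param a u))).
Proof.
have [half half2] := smoothring_half S.
pose J := jacobian_smoothring sF.
have JE u : U u -> J^@u = 'J F u by exact: (@ev_jacobian _ _ _ S F sF u).
have sg := @metric_smooth _ _ _ g b; have sxi := @vf_smooth _ _ _ xi b.
have sal : smooth_on (img b) (alpha \o param b) := @lcs_alpha_smooth _ _ _ _ _ _ hN b.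
pose gr := pullback_mx oW sF FW sg.
pose dg k := pullback_mx oW sF FW (smooth_partial k sg).
pose xr := pullback_mx oW sF FW sxi.
pose dxi k := pullback_mx oW sF FW (smooth_partial k sxi).
pose al : A := pullback sF FW sal.
pose dal k : A := pullback sF FW (smooth_partial k sal).
have gE u : U u -> gr^@u = g b (F u).
  by move=> Uu; exact: (ev_pullback_mx oW sF FW sg Uu).
have dgE k u : U u -> (dg k)^@u = 'D_('e_k) (g b) (F u).
  by move=> Uu; exact: (ev_pullback_mx oW sF FW (smooth_partial k sg) Uu).
have xiE u : U u -> xr^@u = xi b (F u).
  by move=> Uu; exact: (ev_pullback_mx oW sF FW sxi Uu).
have dxiE k u : U u -> (dxi k)^@u = 'D_('e_k) (xi b) (F u).
  by move=> Uu; exact: (ev_pullback_mx oW sF FW (smooth_partial k sxi) Uu).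
have DJ j k p : partial j (J k p) = partial k (J j p) by exact: (jacobian_smoothringC sF).
have Dg j : map_mx (partial j) gr = \sum_k J j k *: dg k.
  by exact: (partial_pullback_mx oW sF FW sg).
have Dxi j : map_mx (partial j) xr = \sum_k J j k *: dxi k.
  by exact: (partial_pullback_mx oW sF FW sxi).
have Dal j : partial j al = \sum_k J j k * dal k by exact: (partial_pullback sF FW sal).
have dalE k u : U u -> ev u (dal k) = 'D_('e_k) (alpha \o param b) (F u).
  by move=> Uu; exact: (ev_pullback sF FW (smooth_partial k sal) Uu).
have alE u : U u -> ev u al = alpha (i (param a u)).
  by move=> Uu; rewrite (ev_pullback sF FW sal Uu)/= overlap_param.
(* rewriting must not look inside these matrices *)
clearbody J gr dg xr dxi al dal.
have gs : gr^T = gr.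
  by apply: ev_mx_inj => u Uu; rewrite -map_trmx gE// lorentzian_sym//; exact: gl.
have unitG u : U u -> (J *m gr *m J^T)^@u \in unitmx.
  move=> Uu; rewrite !map_mxM -map_trmx JE// gE//.
  by apply: timelike_gram_unit (gl Uu) (xiJ Uu) (xi_neg Uu) _; exact: overlap_free Uu.
have [H GH] := @smoothring_invmx _ _ S _ (J *m gr *m J^T) unitG.
pose G := J *m gr *m J^T; pose X := xr *m gr *m J^T *m H.
have GE u : U u -> induced_metric g i a u = G^@u.
  by move=> Uu; rewrite (induced_metricE hM g Uu) !map_mxM -map_trmx JE// gE.
have XE u : U u -> restricted_xi xi i a u = X^@u.
  move=> Uu; rewrite !map_mxM -map_trmx JE// gE// xiE// -(Vxi Uu).
  have := congr1 (map_mx (ev u)) GH.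
  rewrite !map_mxM -map_trmx JE// gE// map_mx1 => E.
  by rewrite -[LHS]mulmx1 -E !mulmxA.
have XJ : X *m J = xr.
  by apply: ev_mx_inj => u Uu; rewrite map_mxM JE// -XE// Vxi// xiE.
have XG : X *m G = xr *m gr *m J^T by rewrite !mulmxA XJ.
have amb p : dxi p *m gr + xr *m ambient_koszul half dg p
    = al *: (row p gr + (xr *m gr) 0 p *: (xr *m gr)).
  apply: ev_mx_inj => u Uu.
  have Wu := FW Uu; have ug := lorentzian_unit (gl Uu).
  have := congr1 (mulmx^~ (g b (F u))) (lcs_nabla_xi hN 'e_p Wu).
  rewrite /cov mulmxDl christoffel_lower//.
  have -> : \row_l (2^-1 * (gdot ('D_('e_p) (g b) (F u)) (xi b (F u)) 'e_l +
       gdot ('D_(xi b (F u)) (g b) (F u)) 'e_p 'e_l -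
       gdot ('D_('e_l) (g b) (F u)) 'e_p (xi b (F u)))) =
     (xr *m ambient_koszul half dg p)^@u.
    rewrite map_mxM xiE//; apply/rowP => l; rewrite !mxE gdot_baser gdot_base gdot_basel.
    rewrite (derive_sum_base (xi b (F u)) (smooth_differentiable sg Wu)).
    rewrite summxE -big_split -sumrB mulr_sumr.
    apply: eq_bigr => q _ /=; rewrite !mxE rmorphM rmorphB rmorphD /= (ev_half half2 u).
    have dgE' k j l' : ev u (dg k j l') = 'D_('e_k) (g b) (F u) j l'.
      by rewrite -dgE// mxE.
    by rewrite !dgE'; ring.
  have -> : phi g xi b (F u) 'e_p = 'e_p + (xi b (F u) *m g b (F u)) 0 p *: xi b (F u).
    rewrite /phi /Defs.eta gdot_basel; congr (_ + _ *: _); rewrite mxE.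
    by apply: eq_bigr => q _; rewrite -[in LHS](lorentzian_sym (gl Uu)) mxE.
  rewrite overlap_param// -alE// => E.
  rewrite map_mxD map_mxM dxiE// gE// E map_mxZ map_mxD map_mxZ -scalemxAl mulmxDl.
  rewrite map_row gE// map_mxM xiE// gE// -scalemxAl -rowE; congr (_ *: (_ + _ *: _)).
  by rewrite -xiE// -gE// -map_mxM mxE.
have DM := @partialM R m S.
have eta_unit : X *m (X *m G)^T = (-1)%:M.
  apply: ev_mx_inj => u Uu; rewrite map_mxM -map_trmx map_mxM -XE// -GE//.
  rewrite (induced_metricE hM g Uu).
  have := Vxi Uu; move: (restricted_xi xi i a u) => v vJ.
  rewrite !trmx_mul trmxK (lorentzian_sym (gl Uu)) !mulmxA vJ.
  rewrite -!mulmxA -trmx_mul vJ map_scalar_mx rmorphN1 mulmxA [LHS]mx11_scalar.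
  by rewrite -/(gdot _ _ _) (lcs_unit hN (FW Uu)) rmorphN1.
apply: (@ConcircularChart _ _ _ _ _ _ half G H X al (- \sum_q xr 0 q * dal q)) => //.
- by rewrite /G !trmx_mul trmxK gs mulmxA.
- by move=> u Uu; rewrite alE.
- by move=> j; exact: (induced_nabla_xi DM half2 gs DJ Dg Dxi amb XJ GH).
move=> j; rewrite Dal XG mxE mulr_sumr; apply: eq_bigr => k _.
rewrite [J^T _ _]mxE (mulrC _ (J j k)) mulrCA; congr (_ * _).
apply: ev_inj => u Uu; rewrite dalE// rmorphM rmorphN rmorph_sum /=.
have dalF := smooth_differentiable sal (FW Uu).
rewrite (lcs_dalpha hN _ (FW Uu)); congr (_ * _).
  rewrite /rho (derive_sum_base _ dalF); congr (- _).
  by apply: eq_bigr => q _; rewrite rmorphM /= dalE// -xiE// mxE.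
transitivity (((xr *m gr)^@u) 0 k); last by rewrite mxE.
rewrite /Defs.eta gdot_basel map_mxM xiE// gE// mxE; apply: eq_bigr => q _.
by rewrite -[in LHS](lorentzian_sym (gl Uu)) mxE.
Qed.

(** The field xi is the combination of the coordinate fields of M with
coefficients its components.  Differentiating that combination, the derivatives
of the coefficients contribute tangent terms, and the derivative of xi itself
is alpha phi(e_k), tangent by invariance. *)
Lemma second_ff_xi k u : U u ->
  \sum_l restricted_xi xi i a u 0 l *:
    second_ff g i a b (fun=> 'e_k) (fun=> 'e_l) u = 0.
Proof.
move=> Uu; have Wu := FW Uu.
have [half G H X al r _ _ _ _ VX _ _ _ _] := overlap_concircular.
set V := restricted_xi xi i a in VX *.
have dV v : derivable V u v := @derivable_smoothring _ _ S _ _ V X u v VX Uu.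
have dJ v : derivable (fun w => 'J F w) u v.
  apply: (@derivable_smoothring _ _ S _ _ _ (jacobian_smoothring sF) u v _ Uu) => w Uw.
  by rewrite ev_jacobian.
have dF := smooth_differentiable sF Uu.
have dg := smooth_differentiable (@metric_smooth _ _ _ g b) Wu.
have dxi := smooth_differentiable (@vf_smooth _ _ _ xi b) Wu.
have VJ : V u *m 'D_('e_k) (fun w => 'J F w) u =
    'D_('e_k *m 'J F u) (xi b) (F u) - 'D_('e_k) V u *m 'J F u.
  have dVJ := is_derive_mulmx (dV 'e_k) (dJ 'e_k).
  apply/eqP; rewrite eq_sym subr_eq addrC -(@derive_val _ _ _ _ _ _ _ dVJ).
  apply/eqP; transitivity ('D_('e_k) (xi b \o F) u); last first.
    apply/near_eq_derive/(open_near_eq (@overlap_open _ _ _ N M i hM a b) Uu) => w Uw.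
    by rewrite /V/= Vxi.
  rewrite (deriveE _ (differentiable_comp dF dxi)) (diff_comp dF dxi) /=.
  by rewrite -(deriveEjacobian _ dF) -(deriveE _ dxi) -(deriveE _ dF).
rewrite /second_ff; set P := proj_mx _ _.
under eq_bigr do rewrite scalemxAl.
rewrite -mulmx_suml /P proj_mx_0//.
  exact: (timelike_normal_cap (gl Uu) (xiJ Uu) (xi_neg Uu)).
rewrite genmxE.
(* linearity of the Christoffel term lets the sum over l pass inside it *)
have [K KE] := christoffel_mulmx ('e_k *m 'J F u) dg.
have -> : \sum_l V u 0 l *:
    cov_along (g b) F 'e_k (fun w => 'e_l *m 'J F w) u =
    cov (g b) ('e_k *m 'J F u) (xi b) (F u) - 'D_('e_k) V u *m 'J F u.
  have E l : cov_along (g b) F 'e_k (fun w => 'e_l *m 'J F w) u =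
      'e_l *m ('D_('e_k) (fun w => 'J F w) u + 'J F u *m K).
    rewrite /cov_along KE mulmxDr mulmxA; congr (_ + _).
    have d := is_derive_mulmx (@derivable_cst _ _ _ ('e_l : 'rV[R]_m) u 'e_k) (dJ 'e_k).
    by rewrite (@derive_val _ _ _ _ _ _ _ d) derive_cst mul0mx add0r.
  under eq_bigr do rewrite E scalemxAl.
  rewrite -mulmx_suml -row_sum_delta mulmxDr VJ mulmxA /V (Vxi Uu).
  by rewrite /cov KE addrAC.
rewrite (lcs_nabla_xi hN _ Wu) addmx_sub// ?scalemx_sub//; last first.
  by rewrite -mulNmx submxMl.
by case: (hinv (proj1 Uu) (proj2 Uu)) => _; apply; exact: submxMl.
Qed.
End Submanifold.

Section Curve.
Variables (R : realType) (n m : nat).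

(** On a curve, h(., xi) = 0 is h = 0 because xi spans the tangent line. *)
Lemma mean_curvature_curve (N : manifold R n) (g : lorentzian_metric N)
    (xi : vector_field N) (M : manifold R m) (i : M -> N) (a : atlas M) (b : atlas N) u :
  m = 1%N -> restricted_xi xi i a u != 0 ->
  (forall k, \sum_l restricted_xi xi i a u 0 l *:
    second_ff g i a b (fun=> 'e_k) (fun=> 'e_l) u = 0) ->
  mean_curvature g i a b u = 0.
Proof.
move=> m1; move: a u; rewrite /mean_curvature; move: M i; subst m => M i a u V0 h0.
rewrite big_ord1 big_ord1; have := h0 ord0; rewrite big_ord1 => /eqP.
rewrite scaler_eq0 => /orP[/eqP V00|/eqP ->]; last by rewrite !scaler0.
by case/eqP: V0; apply/rowP => j; rewrite ord1 V00 mxE.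
Qed.
End Curve.

Theorem theorem3p1 (R : realType) (n m : nat)
    (N : manifold R n) (g : lorentzian_metric N) (xi : vector_field N)
    (alpha : N -> R) (hN : is_LCS g xi alpha)
    (M : manifold R m) (i : M -> N) (hmn : (m < n)%N)
    (hM : submanifold i) (hinv : invariant_submanifold g xi i)
    (lambda : R)
    (hsol : ricci_soliton (induced_metric g i) (restricted_xi xi i) lambda) :
  eta_einstein (induced_metric g i) (restricted_xi xi i) /\
  minimal_submanifold g i.
Proof.
split.
  have smooth_affine (c d : R) : smooth_fun (fun p : M => c * alpha (i p) + d).
    move=> a; apply: smooth_on_local => u au.
    have Uu := overlap_chart_at i au; set b := chart_at _ _ in Uu.
    exists (overlap i a b); first by split => //; exact: overlap_open.
    have [_ _ _ _ al _ _ _ _ _ _ alE _ _ _] := overlap_concircular hN hM hinv Uu.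
    apply: (@smooth_on_ext _ _ _ _ (fun w => c * al w + d)).
    - exact: overlap_open.
    - by move=> w Uw /=; rewrite alE.
    - apply: (smooth_exprW (overlap_open hM (a := a) (b := b))); apply: se_add.
        apply: se_mul; apply: se_base; first exact: smooth_on_cst.
        exact: (smoothring_smooth al).
      exact/se_base/smooth_on_cst.
  exists (fun p => -1 * alpha (i p) + - lambda), (fun p => -1 * alpha (i p) + 0).
  split => // a Y Z sY sZ u au.
  have Uu := overlap_chart_at i au; have chart := overlap_concircular hN hM hinv Uu.
  have := hsol a Y Z sY sZ u au.
  rewrite (concircular_lie_metric chart Uu (smooth_differentiable sY au)
    (smooth_differentiable sZ au)).
  move: (ricci _ _ _ _) (gdot _ _ _) (gdot _ _ _) (gdot _ _ _) => s y z w; lra.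
move=> a b u au bu; have Uu : overlap i a b u by [].
have chart := overlap_concircular hN hM hinv Uu.
apply: (@mean_curvature_curve _ _ _ _ _ xi).
- apply: (concircular_soliton_dim chart Uu (lcs_alpha_neq0 hN _)) => j k w Uw.
  apply: (hsol a (fun=> 'e_j) (fun=> 'e_k)); [exact: smooth_on_cst..|exact: (proj1 Uw)].
- apply/eqP => V0; have := lcs_unit hN (@overlap_img _ _ _ N M i a b u Uu).
  rewrite -(@restricted_xiE _ _ _ N M i hM a xi b u Uu); last by case: (hinv _ _ _ au bu).
  by rewrite V0 mul0mx /gdot !mul0mx mxE => /eqP; rewrite eq_sym oppr_eq0 oner_eq0.
- by move=> k; exact: (second_ff_xi hN hM hinv Uu k Uu).
Qed.
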